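(* Let $C[F;H]$ be the Lorentzian cylinder constructed out of a connected Riemannian manifold $(F,g_F)$ (admitting a non-vanishing parallel spinor and a Codazzi tensor with eigenvalues uniformly bounded from below) and a Codazzi tensor $H$ on the warped product $(\mathbb{R}\times F, ds^2+e^{-4s}g_F)$ with positive eigenvalues uniformly bounded away from zero. If the Riemannian manifold $(F,g_F)$ is complete, then the cylinder $C[F;H]$ is globally hyperbolic and even bbc.
   Context: A Codazzi tensor on a Riemannian manifold $(N,h)$ is an $h$-symmetric endomorphism field $T$ of $TN$ with $(\nabla_XT)(Y)=(\nabla_YT)(X)$ for all vector fields $X,Y$. For an invertible endomorphism field $B$ and a metric $h$, $B^*h(X,Y):=h(BX,BY)$. The cylinder $C[F;H]$: let $(F,g_F)$ be a connected Riemannian manifold which admits a non-vanishing parallel spinor and a Codazzi tensor with eigenvalues uniformly bounded from below. Put $M:=\mathbb{R}\times F$ (with coordinate $s$ on $\mathbb{R}$) and $g_{wp}:=ds^2+e^{-4s}g_F$, and let $H$ be a Codazzi tensor on $(M,g_{wp})$ with positive eigenvalues uniformly bounded away from zero ($\|H^{-1}\|\le c<\infty$ on $M$). Then $$C[F;H]:=(a,b)\times M=(a,b)\times\mathbb{R}\times F,\qquad g_C:=-dt^2+(H-2t\,\mathrm{Id})^*(ds^2+e^{-4s}g_F),$$ where $a$ is half of the supremum of all negative eigenvalues of $H$, or $-\infty$ if all eigenvalues of $H$ are positive, and $b$ is half of the infimum of all positive eigenvalues of $H$, or $+\infty$ if all eigenvalues are negative. A Lorentzian manifold $(C,g)$ is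 called bbc if it is isometric to $\mathbb{R}\times M$ with metric $-f\,dt^2\oplus g_t$, where $f$ is a smooth positive function which is bounded on every $\{t\}\times M$, $g_t$ is a family of complete Riemannian metrics on $M$, and for every $t$ the eigenvalues of $\dot g_t\circ g_t^{-1}$ are uniformly bounded on $\{t\}\times M$ (an interval $(a,b)$ is identified with $\mathbb{R}$ by a diffeomorphism). *)

(* Defs.v *)
From HB Require Import structures.
From mathcomp Require Import all_boot all_order all_algebra.
From mathcomp Require Import all_classical all_reals all_analysis.
From mathcomp Require Import complex.
Set Implicit Arguments.
Unset Strict Implicit.
Unset Printing Implicit Defensive.
Import Order.TTheory GRing.Theory Num.Theory numFieldNormedType.Exports.
Local Open Scope classical_set_scope.
Local Open Scope ring_scope.

(* MathComp and MathComp-Analysis. *)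

(* [Ck k U f]: f is of class C^k on the open set U.  For finite-dimensional E,
   f is C^(k+1) iff it is differentiable and (x, v) |-> 'd f x v, which is
   linear in v, is C^k on U x E. *)
Fixpoint Ck (R : realType) (k : nat) (E V : normedModType R) (U : set E)
    (f : E -> V) {struct k} : Prop :=
  if k is k'.+1 then
    (forall x, U x -> differentiable f x) /\
    @Ck R k' ((E * E)%type : normedModType R) V (U `*` setT)
      (fun z : E * E => let: (x, v) := z in 'd f x v)
  else forall x, U x -> {for x, continuous f}.

Definition smooth (R : realType) (E V : normedModType R) (U : set E)
  (f : E -> V) : Prop := forall k, Ck k U f.

(* An atlas modelled on E.  The underlying manifold is the union of the chart
   domains, an open subset of the topological space [pt]; this makes open
   submanifolds atlases on the same type.  The maps [fwd i] and [bwd i] are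
   mutually inverse between [dom i] and [img i]; their values elsewhere are
   irrelevant. *)
Record atlas (R : realType) (E : normedModType R) := Atlas {
  pt : topologicalType;
  ix : Type;
  dom : ix -> set pt;
  fwd : ix -> pt -> E;
  bwd : ix -> E -> pt }.

Section Atlas.
Context (R : realType) (E : normedModType R) (A : atlas E).

Definition supp : set (pt A) := [set p | exists i : ix A, dom i p].

Definition img (i : ix A) : set E := fwd i @` dom i.

Definition trans (i j : ix A) : E -> E := fwd j \o bwd i.

Record manifold : Prop := Manifold {
  model_findim : exists k (b : 'I_k -> E),
    forall v, exists c : 'I_k -> R, v = \sum_l c l *: b l;
  mfd_hausdorff : hausdorff_space (pt A);
  mfd_second_countable : second_countable (T := pt A);
  dom_open : forall i : ix A, open (dom i);
  img_open : forall i, open (img i);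
  fwdK : forall (i : ix A) p, dom i p -> bwd i (fwd i p) = p;
  fwd_continuous : forall (i : ix A) p, dom i p -> {for p, continuous (fwd i)};
  bwd_continuous : forall i x, img i x -> {for x, continuous (bwd (a := A) i)};
  trans_smooth : forall i j : ix A,
    smooth (fwd i @` (dom i `&` dom j)) (trans i j) }.

(* Tensor fields are given by their components in each chart i, at the points
   of [img i]. *)
Definition bilin_field := ix A -> E -> E -> E -> R.
Definition endo_field := ix A -> E -> E -> E.

Definition metric_field (g : bilin_field) : Prop :=
  [/\ forall i x u, img i x -> scalar (g i x u),
      forall i x u v, img i x -> g i x u v = g i x v u,
      forall i u v, smooth (img i) (fun x => g i x u v) &
      forall i j x u v, (fwd i @` (dom i `&` dom j)) x ->
        g i x u v = g j (trans i j x) ('d (trans i j) x u) ('d (trans i j) x v)].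

Definition riemannian (g : bilin_field) : Prop :=
  metric_field g /\ forall i x u, img i x -> u != 0 -> 0 < g i x u u.

Definition lorentzian (g : bilin_field) : Prop :=
  metric_field g /\
  forall i x, img i x -> exists2 u, g i x u u < 0 &
    forall v, g i x u v = 0 -> v != 0 -> 0 < g i x v v.

Definition smooth_endo (T : endo_field) : Prop :=
  [/\ forall i x, img i x -> linear (T i x),
      forall i u, smooth (img i) (fun x => T i x u) &
      forall i j x u, (fwd i @` (dom i `&` dom j)) x ->
        'd (trans i j) x (T i x u) = T j (trans i j x) ('d (trans i j) x u)].

(* Christoffel map of the Levi-Civita connection in the chart i, given by the
   Koszul formula for constant (hence commuting) coordinate fields. *)
Definition christoffel (g : bilin_field) (i : ix A) (x u v : E) : E :=
  xget 0 [set z | forall w, 2 * g i x z w =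
    'd (fun y => g i y v w) x u + 'd (fun y => g i y u w) x v
    - 'd (fun y => g i y u v) x w].

Definition cov_vec (g : bilin_field) (i : ix A) (x u : E) (X : E -> E) : E :=
  'd X x u + christoffel g i x u (X x).

(* (nabla_u T)(v) *)
Definition cov_endo (g : bilin_field) (T : endo_field) (i : ix A) (x u v : E) :=
  cov_vec g i x u (fun y => T i y v) - T i x (christoffel g i x u v).

Definition codazzi (g : bilin_field) (T : endo_field) : Prop :=
  [/\ smooth_endo T,
      forall i x u v, img i x -> g i x (T i x u) v = g i x u (T i x v) &
      forall i x u v, img i x -> cov_endo g T i x u v = cov_endo g T i x v u].

Definition eigenvalues (T : endo_field) : set R :=
  [set l | exists i x v, [/\ img i x, v != 0 & T i x v = l *: v]].

Definition velocity (c : R -> pt A) (i : ix A) (t : R) : E :=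
  derive1 (fwd i \o c) t.

(* Every open interval is diffeomorphic to the real line, and a C^1 curve on
   [0, 1] is the restriction of one on the real line, so that it is enough to
   consider curves parametrised by the whole line. *)
Definition C1_curve (c : R -> pt A) : Prop :=
  [/\ forall t, supp (c t), continuous c &
      forall i t, dom i (c t) ->
        derivable (fwd i \o c) t 1 /\ {for t, continuous (velocity c i)}].

(* The values [g i _ (velocity c i t) (velocity c i t)] agree for all charts i
   around [c t]. *)
Definition speed (g : bilin_field) (c : R -> pt A) (t : R) : R :=
  xget 0 [set r | exists2 i, dom i (c t) &
    r = Num.sqrt (g i (fwd i (c t)) (velocity c i t) (velocity c i t))].

(* [joined g p q l]: some piecewise C^1 curve from p to q has length l. *)
Inductive joined (g : bilin_field) : pt A -> pt A -> R -> Prop :=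
| joined_C1 c : C1_curve c ->
    joined g (c 0) (c 1) (\int[lebesgue_measure]_(t in `[0, 1]) speed g c t)
| joined_cat p q r l1 l2 :
    joined g p q l1 -> joined g q r l2 -> joined g p r (l1 + l2).

Definition riem_dist (g : bilin_field) (p q : pt A) : \bar R :=
  ereal_inf [set l%:E | l in joined g p q].

Definition complete_metric (g : bilin_field) : Prop :=
  forall u : nat -> pt A, (forall k, supp (u k)) ->
    (forall e : R, 0 < e -> exists N : nat, forall k l : nat,
      (N <= k)%N -> (N <= l)%N -> (riem_dist g (u k) (u l) < e%:E)%E) ->
    exists2 p, supp p & forall e : R, 0 < e -> exists N : nat, forall k : nat,
      (N <= k)%N -> (riem_dist g (u k) p < e%:E)%E.

Definition timelike_curve (g : bilin_field) (c : R -> pt A) : Prop :=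
  C1_curve c /\ forall i t, dom i (c t) ->
    g i (fwd i (c t)) (velocity c i t) (velocity c i t) < 0.

Definition inextendible (c : R -> pt A) : Prop :=
  (forall p, supp p -> ~ (c @ +oo --> p)) /\
  (forall p, supp p -> ~ (c @ -oo --> p)).

(* Time-orientability is part of global hyperbolicity here: it does not follow
   from the existence of a set that every inextendible timelike curve meets
   exactly once. *)
Definition cauchy_hypersurface (g : bilin_field) (S : set (pt A)) : Prop :=
  S `<=` supp /\ forall c, timelike_curve g c -> inextendible c ->
    exists! t, S (c t).

Definition time_orientable (g : bilin_field) : Prop :=
  exists X : ix A -> E -> E,
  [/\ forall i x, img i x -> {for x, continuous (X i)},
      forall i j x, (fwd i @` (dom i `&` dom j)) x ->
        'd (trans i j) x (X i x) = X j (trans i j x) &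
      forall i x, img i x -> g i x (X i x) (X i x) < 0].

Definition globally_hyperbolic (g : bilin_field) : Prop :=
  [/\ manifold, lorentzian g, time_orientable g &
      exists S, cauchy_hypersurface g S].

Definition restrict (O : set (pt A)) : atlas E :=
  Atlas (fun i : ix A => dom i `&` O) (@fwd _ _ A) (@bwd _ _ A).

(* The product of the real line with A, modelled on R * E. *)
Definition line_prod : atlas ((R * E)%type : normedModType R) :=
  @Atlas R ((R * E)%type : normedModType R) (R * pt A)%type (ix A)
    (fun i p => dom i p.2) (fun i p => (p.1, fwd i p.2))
    (fun i x => (x.1, bwd i x.2)).

End Atlas.

Definition smooth_map (R : realType) (E1 E2 : normedModType R)
    (A : atlas E1) (B : atlas E2) (Phi : pt A -> pt B) : Prop :=
  (forall p, supp p -> supp (Phi p) /\ {for p, continuous Phi}) /\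
  (forall (i : ix A) (j : ix B),
    smooth (fwd i @` (dom i `&` Phi @^-1` dom j)) (fwd j \o Phi \o bwd i)).

Definition isometric (R : realType) (E1 E2 : normedModType R)
    (A : atlas E1) (g : bilin_field A) (B : atlas E2) (h : bilin_field B) :=
  exists (Phi : pt A -> pt B) (Psi : pt B -> pt A),
  [/\ smooth_map Phi /\ smooth_map Psi,
      forall p, supp p -> Psi (Phi p) = p,
      forall q, supp q -> Phi (Psi q) = q &
      forall (i : ix A) (j : ix B) p u v, dom i p -> dom j (Phi p) ->
        let dPhi := 'd (fwd j \o Phi \o bwd i) (fwd i p) in
        g i (fwd i p) u v = h j (fwd j (Phi p)) (dPhi u) (dPhi v)].

Section Bbc.
Context (R : realType) (E : normedModType R) (M : atlas E).

(* - f dt^2 + g_t on the product of the real line with M *)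
Definition split_metric (f : R -> pt M -> R) (gt : R -> bilin_field M) :
    bilin_field (line_prod M) :=
  fun i x u v =>
    - f x.1 (bwd (a := M) i x.2) * u.1 * v.1 + gt x.1 i x.2 u.2 v.2.

(* Eigenvalues, over all points of M, of the endomorphism
   (d/dt g_t) o g_t^-1 of the cotangent spaces: the eigencovector is written
   as g_t(v, .). *)
Definition rate_eigenvalues (gt : R -> bilin_field M) (t : R) : set R :=
  [set l | exists i x v, [/\ img i x, v != 0 &
    forall w, derive1 (fun s => gt s i x v w) t = l * gt t i x v w]].

(* Conditions on f and g_t; an interval (a, b) of times is identified with the
   real line by the isometry in [bbc] below. *)
Record bbc_split (f : R -> pt M -> R) (gt : R -> bilin_field M) : Prop := {
  bbc_manifold : manifold M;
  bbc_f_smooth : forall i : ix M,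
    @smooth R ((R * E)%type : normedModType R) R (setT `*` img i)
      (fun x : R * E => f x.1 (bwd i x.2));
  bbc_f_pos : forall t p, supp p -> 0 < f t p;
  bbc_f_bounded : forall t, exists K, forall p, supp p -> f t p <= K;
  bbc_g_smooth : forall (i : ix M) u v,
    @smooth R ((R * E)%type : normedModType R) R (setT `*` img i)
      (fun x : R * E => gt x.1 i x.2 u v);
  bbc_g_riemannian : forall t, riemannian (gt t);
  bbc_g_complete : forall t, complete_metric (gt t);
  bbc_rate_bounded : forall t, exists K, forall l,
    rate_eigenvalues gt t l -> `|l| <= K }.

End Bbc.

Definition bbc (R : realType) (E : normedModType R) (C : atlas E)
    (g : bilin_field C) : Prop :=
  [/\ manifold C, lorentzian g &
      exists (E0 : normedModType R) (M : atlas E0) (f : R -> pt M -> R)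
        (gt : R -> bilin_field M),
        bbc_split f gt /\ isometric (split_metric f gt) g].

Section Spin.
Context (R : realType) (n : nat) (F : atlas ('rV[R]_n : normedModType R)).

(* Complex dimension of the spinor module. *)
Local Notation N := (2 ^ n./2)%N.

(* Generators of the complex spin representation.  A module of dimension
   2 ^ [n/2] over the Clifford algebra is irreducible; for odd n the two
   inequivalent ones coincide on Spin(n). *)
Definition clifford_rep (gam : 'I_n -> 'M[R[i]]_N) : Prop :=
  forall k l, gam k *m gam l + gam l *m gam k = - (2 *+ (k == l))%:M.

Definition clifford_mul (gam : 'I_n -> 'M[R[i]]_N) (v : 'I_n -> R) :=
  \sum_k (v k)%:C%C *: gam k.

(* The image of Spin(n), on which the representation is faithful: products of
   an even number of unit vectors. *)
Definition Spin (gam : 'I_n -> 'M[R[i]]_N) (a : 'M[R[i]]_N) : Prop :=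
  exists s : seq ('I_n -> R),
  [/\ ~~ odd (size s),
      forall m, (m < size s)%N -> \sum_k nth (fun=> 0) s m k ^+ 2 = 1 &
      a = \prod_(v <- s) clifford_mul gam v].

(* The existence of a lift to Spin(n) forces the frames to be consistently
   oriented.  A spin structure on (F, g) is given as a Spin(n)-cocycle lifting the transition
   functions of the orthonormal frame bundle: [loc a] is an open cover of F by
   subsets of chart domains, [frame a] an orthonormal frame over [loc a], and
   [lift a b] lifts the matrix (g(e^a_l, e^b_k))_(l, k) that expresses the frame
   over [loc b] in that over [loc a]. *)
Record spin_structure (g : bilin_field F) (gam : 'I_n -> 'M[R[i]]_N) :=
    SpinStructure {
  loc_ix : Type;
  loc : loc_ix -> set (pt F);
  chart : loc_ix -> ix F;
  frame : loc_ix -> 'I_n -> 'rV[R]_n -> 'rV[R]_n;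
  lift : loc_ix -> loc_ix -> pt F -> 'M[R[i]]_N;
  loc_open : forall a, open (loc a);
  loc_chart : forall a, loc a `<=` dom (chart a);
  loc_cover : forall p, supp p -> exists a, loc a p;
  frame_smooth : forall a k, smooth (fwd (chart a) @` loc a) (frame a k);
  frame_orthonormal : forall a k l p, loc a p ->
    let x := fwd (chart a) p in
    g (chart a) x (frame a k x) (frame a l x) = (k == l)%:R;
  lift_spin : forall a b p, loc a p -> loc b p -> Spin gam (lift a b p);
  lift_continuous : forall a b p r s, loc a p -> loc b p ->
    {for p, continuous (fun q => complex.Re (lift a b q r s))} /\
    {for p, continuous (fun q => complex.Im (lift a b q r s))};
  lift_cover : forall a b p k, loc a p -> loc b p ->
    let x := fwd (chart a) p in
    let y := fwd (chart b) p in
    let ebk := 'd (trans (chart b) (chart a)) y (frame b k y) in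
    lift a b p *m gam k =
      clifford_mul gam (fun l => g (chart a) x (frame a l x) ebk)
        *m lift a b p;
  lift_cocycle : forall a b c p, loc a p -> loc b p -> loc c p ->
    lift a b p *m lift b c p = lift a c p }.

Definition cderiv (f : 'rV[R]_n -> R[i]) (x u : 'rV[R]_n) : R[i] :=
  Complex ('d (fun y => complex.Re (f y) : R) x u)
          ('d (fun y => complex.Im (f y) : R) x u).

(* [psi a], over the coordinates of [chart a], represents a smooth section of
   the spinor bundle in the trivialisation over [loc a]. *)
Definition spinor_field (g : bilin_field F) gam (S : spin_structure g gam)
    (psi : loc_ix S -> 'rV[R]_n -> 'cV[R[i]]_N) : Prop :=
  (forall a r, smooth (fwd (chart a) @` loc a)
      (fun x => complex.Re (psi a x r 0) : R) /\
    smooth (fwd (chart a) @` loc a) (fun x => complex.Im (psi a x r 0) : R)) /\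
  (forall a b p, loc a p -> loc b p ->
    psi a (fwd (chart a) p) = lift a b p *m psi b (fwd (chart b) p)).

(* nabla_u psi = d psi(u) + 1/2 sum_(k < l) g(nabla_u e_k, e_l) e_k . e_l . psi *)
Definition cov_spinor (g : bilin_field F) gam (S : spin_structure g gam)
    (psi : loc_ix S -> 'rV[R]_n -> 'cV[R[i]]_N) (a : loc_ix S)
    (x u : 'rV[R]_n) : 'cV[R[i]]_N :=
  (\col_r cderiv (fun y => psi a y r 0) x u) +
  \sum_(k < n) \sum_(l < n | (k < l)%N)
    (2^-1 * g (chart a) x (cov_vec g (chart a) x u (frame a k))
              (frame a l x))%:C%C *: (gam k *m gam l *m psi a x).

Definition admits_parallel_spinor (g : bilin_field F) : Prop :=
  exists (gam : 'I_n -> 'M[R[i]]_N) (S : spin_structure g gam)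
    (psi : loc_ix S -> 'rV[R]_n -> 'cV[R[i]]_N),
  [/\ clifford_rep gam, spinor_field psi,
      forall a x u, (fwd (chart a) @` loc a) x -> cov_spinor psi a x u = 0 &
      forall a x, (fwd (chart a) @` loc a) x -> psi a x != 0].

End Spin.

Section Cylinder.
Context (R : realType) (E : normedModType R) (F : atlas E).
Context (gF : bilin_field F) (H : endo_field (line_prod F)).

(* ds^2 + e^(-4s) g_F *)
Definition warped_metric : bilin_field (line_prod F) :=
  fun i x u v => u.1 * v.1 + expR (- 4 * x.1) * gF i x.2 u.2 v.2.

(* The supremum (infimum) of the empty set is -oo (+oo). *)
Definition cyl_left : \bar R :=
  ((2^-1)%:E * ereal_sup [set l%:E | l in [set l | eigenvalues H l /\ (l < 0)%R]])%E.

Definition cyl_right : \bar R :=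
  ((2^-1)%:E * ereal_inf [set l%:E | l in [set l | eigenvalues H l /\ (0 < l)%R]])%E.

Definition cylinder : atlas ((R * (R * E))%type : normedModType R) :=
  @restrict R ((R * (R * E))%type : normedModType R) (line_prod (line_prod F))
    [set p : R * (R * pt F) | (cyl_left < p.1%:E)%E /\ (p.1%:E < cyl_right)%E].

(* - dt^2 + (H - 2t Id)^* (ds^2 + e^(-4s) g_F) *)
Definition cylinder_metric : bilin_field cylinder :=
  fun i x u v =>
    let B w := H i x.2 w - (2 * x.1) *: w in
    - (u.1 * v.1) + warped_metric i x.2 (B u.2) (B v.2).

End Cylinder.

Arguments cylinder_metric {R E F} gF H.

(* Main.v *)
Require Import Defs.
From HB Require Import structures.
From mathcomp Require Import all_boot all_order all_algebra.
From mathcomp Require Import all_classical all_reals all_analysis.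
From mathcomp Require Import ring lra.
Set Implicit Arguments.
Unset Strict Implicit.
Unset Printing Implicit Defensive.
Import Order.TTheory GRing.Theory Num.Theory numFieldNormedType.Exports.
Local Open Scope classical_set_scope.
Local Open Scope ring_scope.

(** Let g_wp = ds^2 + e^(-4s) g_F on M = R x F. The slice of the cylinder at
   time t carries the metric h_t = (H - 2t)^* g_wp. Let beta be the infimum of
   the eigenvalues of H, so that times range over (-oo, beta/2). As the
   symmetric endomorphism H is bounded below by its smallest eigenvalue
   ([rayleigh_endo]), Cauchy-Schwarz gives h_t(v, v) >= (beta - 2t)^2 g_wp(v, v)
   ([shift_metric_lower]). Everything follows from this estimate and from the
   completeness of g_wp.

   The warped metric is complete ([warped_complete]) because a path of length l
   changes the coordinate s by at most l; on a region where s is bounded above,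
   the factor e^(-4s) is bounded below, so that short paths project to short
   paths of F, and Cauchy sequences to Cauchy sequences. By the estimate above
   every h_t is then complete as well ([complete_compare]). Passing between
   distances in this way rests on the fact that the distance of a Riemannian
   metric induces the topology of the manifold ([joined_short_nbhs],
   [near_joined_short]).

   Global hyperbolicity ([cyl_cauchy]): along a timelike curve (t, x) the
   estimate reads (beta - 2t) |x'| < |t'|, so that t is strictly monotone and
   takes each value at most once. If it omits the value t0, then towards one of
   the two ends of the curve t is bounded and stays away from beta/2. There the
   g_wp-length of x is at most a constant times the variation of t, hence
   finite, and completeness gives x a limit ([curve_cvg]); the curve is not
   inextendible.

   The bbc splitting: with t = beta/2 - e^(-s) the metric becomes
   - e^(-2s) ds^2 + h_t on R x M ([slice_isometric]), whose first coefficient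
   is constant on slices. The logarithmic rate of change of h_t is bounded by 2
   ([slice_rate]), by the same estimate. *)

(** * Calculus of maps of class C^k *)

Section Calculus.
Context {R : realType}.
Implicit Types E V W : normedModType R.

Lemma diff_near_eq E V (f g : E -> V) x :
  (\near x, f x = g x) -> differentiable f x ->
  differentiable g x /\ 'd g x = 'd f x :> (E -> V).
Proof.
move=> fg df.
have fgx : f x = g x by apply: nbhs_singleton fg.
have [dfc dfe] := proj1 (diff_locallyxP _ _) df.
have fg0 : \forall h \near (0 : E), f (h + x) = g (h + x).
  have : (fun h => h + x) @ (0 : E) --> x.
    by rewrite -[X in _ --> X]add0r; apply: cvgD; [exact: cvg_id|exact: cvg_cst].
  by move=> /(_ _ fg).
have key : g \o shift x = cst (g x) + 'd f x +o_ 0 id.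
  apply/eqaddoP => e e0.
  have := diff_locally df; rewrite -fgx => /eqaddoP /(_ e e0) dfe'.
  near=> h.
  have -> : (g \o shift x - (cst (f x) + 'd f x)) h =
    (f \o shift x - (cst (f x) + 'd f x)) h.
    by rewrite !fctE /=; congr (_ - _); symmetry; near: h.
  by near: h.
have dE : 'd g x = 'd f x :> (E -> V) by apply: diff_unique.
split; last exact: dE.
by apply/diff_locallyP; rewrite dE; split.
Unshelve. all: by end_near. Qed.

Lemma CkSP k E V (U : set E) (f : E -> V) :
  Ck k.+1 U f <-> (forall x, U x -> differentiable f x) /\
    @Ck R k (E * E)%type V (U `*` setT) (fun z : E * E => 'd f (z.1) (z.2)).
Proof.
have -> : (fun z : E * E => 'd f (z.1) (z.2)) =
  (fun z : E * E => let: (x, v) := z in 'd f x v) by apply/funext => -[].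
by [].
Qed.

Lemma Ck_sub k E V (U U' : set E) (f : E -> V) :
  U' `<=` U -> Ck k U f -> Ck k U' f.
Proof.
elim: k E U U' f => [|k IH] E U U' f UU'; first by move=> h x /UU'; exact: h.
move=> /CkSP[df Cf]; apply/CkSP; split=> [x /UU'|]; first exact: df.
by apply: IH Cf => -[x v] [/= /UU'].
Qed.

Lemma openXT E V (U : set E) : open U -> open (U `*` (@setT V)).
Proof.
move=> oU.
have -> : U `*` [set: V] = fst @^-1` U by apply/seteqP; split=> -[x y] //= [].
by apply: open_comp => // z _; exact: cvg_fst.
Qed.

Lemma Ck_eq k E V (U : set E) (f g : E -> V) : open U ->
  (forall x, U x -> f x = g x) -> Ck k U f -> Ck k U g.
Proof.
elim: k E U f g => [|k IH] E U f g oU fg.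
  move=> Cf x Ux; rewrite /prop_for /continuous_at -fg//.
  have := Cf x Ux; rewrite /prop_for /continuous_at; apply: cvg_trans.
  apply: near_eq_cvg; near=> y; apply: fg; near: y.
  exact: open_nbhs_nbhs.
move=> /CkSP[df Cf].
have fgx x : U x -> \near x, f x = g x.
  by move=> Ux; near=> y; apply: fg; near: y; exact: open_nbhs_nbhs.
apply/CkSP; split=> [x Ux|]; first by have [] := diff_near_eq (fgx x Ux) (df x Ux).
apply: (IH _ _ _ _ (openXT oU)) Cf => -[x v] [/= Ux _].
by have [_] := diff_near_eq (fgx x Ux) (df x Ux) => /= ->.
Unshelve. all: by end_near. Qed.

Lemma Ck_S k E V (U : set E) (f : E -> V) : Ck k.+1 U f -> Ck k U f.
Proof.
elim: k E U f => [|k IH] E U f.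
  by move=> [df _] x Ux; apply: differentiable_continuous; apply: df.
move=> /CkSP[df Cf]; apply/CkSP; split=> //.
exact: IH.
Qed.

Lemma Ck_cst k E V (U : set E) (a : V) : Ck k U (cst a : E -> V).
Proof.
elim: k E V U a => [|k IH] E V U a; first by move=> x _; exact: cst_continuous.
apply/CkSP; split=> [x _|]; first exact: differentiable_cst.
have -> : (fun z : E * E => 'd (cst a : E -> V) (z.1) (z.2)) = cst 0.
  by apply/funext => z; rewrite diff_cst.
exact: IH.
Qed.

Lemma Ck_lin k E V (U : set E) (f : {linear E -> V}) :
  continuous f -> Ck k U f.
Proof.
elim: k E U f => [|k IH] E U f fc; first by move=> x _; exact: fc.
apply/CkSP; split=> [x _|]; first exact: linear_differentiable.
have -> : (fun z : E * E => 'd f (z.1) (z.2)) = (f \o snd).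
  by apply/funext => z; rewrite diff_lin.
apply: (IH _ _ (f \o snd)) => z; apply: continuous_comp; last exact: fc.
exact: cvg_snd.
Qed.

Lemma Ck_id k E (U : set E) : Ck k U (@id E).
Proof. by apply: (@Ck_lin k E E U idfun) => x. Qed.

Lemma Ck_fst k E V (U : set (E * V)) : @Ck R k (E * V)%type E U fst.
Proof. by apply: (@Ck_lin k _ _ U fst) => x; exact: cvg_fst. Qed.

Lemma Ck_snd k E V (U : set (E * V)) : @Ck R k (E * V)%type V U snd.
Proof. by apply: (@Ck_lin k _ _ U snd) => x; exact: cvg_snd. Qed.

Lemma Ck_pair k E V W (U : set E) (f : E -> V) (g : E -> W) : open U ->
  Ck k U f -> Ck k U g -> @Ck R k E (V * W)%type U (fun x => (f x, g x)).
Proof.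
elim: k E U f g => [|k IH] E U f g oU.
  move=> Cf Cg x Ux; rewrite /prop_for /continuous_at.
  by apply: cvg_pair; [exact: Cf|exact: Cg].
move=> /CkSP[df Cf] /CkSP[dg Cg]; apply/CkSP; split=> [x Ux|].
  by apply: differentiable_pair; [exact: df|exact: dg].
apply: Ck_eq (IH _ _ _ _ (openXT oU) Cf Cg); first exact: openXT.
by move=> -[x v] [/= Ux _]; rewrite diff_pair//; [exact: df|exact: dg].
Qed.

(** The differential of g o f is the differential of g composed with
   (x, v) |-> (f x, 'd f x v), so that the induction on k goes through. *)
Lemma Ck_comp k E V W (U : set E) (U' : set V) (f : E -> V) (g : V -> W) :
  open U -> open U' -> (forall x, U x -> U' (f x)) ->
  Ck k U f -> Ck k U' g -> Ck k U (g \o f).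
Proof.
elim: k E V W U U' f g => [|k IH] E V W U U' f g oU oU' UU'.
  by move=> Cf Cg x Ux; apply: continuous_comp; [exact: Cf|exact/Cg/UU'].
move=> Cf' /CkSP[dg Cg]; move: (Cf') => /CkSP[df Cf]; apply/CkSP; split=> [x Ux|].
  by apply: differentiable_comp; [exact: df|exact/dg/UU'].
have H1 : @Ck R k (E * E)%type V (U `*` setT) (f \o fst).
  apply: (IH (E * E)%type E V _ U) => //; first exact: openXT.
  - by move=> -[? ?] [].
  - exact: Ck_fst.
  - exact: Ck_S.
have H2 := Ck_pair (openXT oU) H1 Cf.
have H3 := IH _ (V * V)%type W _ _ _ _ (openXT oU) (openXT oU') _ H2 Cg.
apply: (Ck_eq _ _ (H3 _)); first exact: openXT.
- by move=> -[x v] [/= Ux _]; rewrite (diff_comp (df _ Ux) (dg _ (UU' _ Ux))).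
- by move=> -[x v] [/= Ux _]; split=> //=; exact: UU'.
Qed.

Lemma Ck_add k E V (U : set E) (f g : E -> V) : open U ->
  Ck k U f -> Ck k U g -> Ck k U (fun x => f x + g x).
Proof.
elim: k E U f g => [|k IH] E U f g oU.
  by move=> Cf Cg x Ux; apply: continuousD; [exact: Cf|exact: Cg].
move=> /CkSP[df Cf] /CkSP[dg Cg]; apply/CkSP; split=> [x Ux|].
  by apply: differentiableD; [exact: df|exact: dg].
apply: Ck_eq (IH _ _ _ _ (openXT oU) Cf Cg); first exact: openXT.
by move=> -[x v] [/= Ux _]; rewrite diffD//; [exact: df|exact: dg].
Qed.

Lemma Ck_mul k E (U : set E) (f g : E -> R) : open U ->
  Ck k U f -> Ck k U g -> Ck k U (fun x => f x * g x).
Proof.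
elim: k E U f g => [|k IH] E U f g oU.
  by move=> Cf Cg x Ux; apply: continuousM; [exact: Cf|exact: Cg].
move=> Cf' Cg'; move: (Cf') (Cg') => /CkSP[df Cf] /CkSP[dg Cg].
apply/CkSP; split=> [x Ux|].
  by apply: differentiableM; [exact: df|exact: dg].
have H1 (h : E -> R) : Ck k.+1 U h ->
    @Ck R k (E * E)%type R (U `*` setT) (h \o fst).
  move=> /Ck_S Ch; apply: (Ck_comp (openXT oU) oU) => //.
  - by move=> -[? ?] [].
  - exact: Ck_fst.
apply: (Ck_eq _ _ (Ck_add (openXT oU)
  (IH _ _ _ _ (openXT oU) (H1 _ Cf') Cg) (IH _ _ _ _ (openXT oU) (H1 _ Cg') Cf))).
  exact: openXT.
by move=> -[x v] [/= Ux _]; rewrite diffM//; [exact: df|exact: dg].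
Qed.

Lemma Ck_sum k E V (I : finType) (U : set E) (f : I -> E -> V) : open U ->
  (forall i, Ck k U (f i)) -> Ck k U (fun x => \sum_i f i x).
Proof.
move=> oU Cf; elim: (index_enum I) => [|i s IH].
  have -> : (fun x => \sum_(i <- [::]) f i x) = cst 0.
    by apply/funext => x; rewrite big_nil.
  exact: Ck_cst.
have -> : (fun x => \sum_(j <- i :: s) f j x) =
    (fun x => f i x + \sum_(j <- s) f j x).
  by apply/funext => x; rewrite big_cons.
exact: Ck_add.
Qed.

Lemma Ck_opp k E (U : set E) (f : E -> R) : open U ->
  Ck k U f -> Ck k U (fun x => - f x).
Proof.
move=> oU Cf; have := Ck_mul oU (Ck_cst k U (-1 : R)) Cf.
by apply: Ck_eq => // x _; rewrite mulN1r.
Qed.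

Lemma is_derive_diff (f : R -> R) (x df : R) : is_derive x 1 f df ->
  differentiable f x /\ 'd f x = (fun h => h * df) :> (R -> R).
Proof.
move=> h; have dfx : derivable f x 1 by apply: ex_derive.
split; first by apply/derivable1_diffP.
by rewrite deriv1E// derive1E derive_val.
Qed.

(** In one variable 'd f x v is the product of v and the ordinary derivative, so
   that regularity can be read off the latter. *)
Lemma Ck_antiderivative k (U : set R) (f h : R -> R) : open U ->
  (forall x : R, U x -> is_derive x 1 f (h x)) -> Ck k U h -> Ck k.+1 U f.
Proof.
move=> oU fh Ch; apply/CkSP; split=> [x /fh /is_derive_diff[]//|].
have H : @Ck R k (R * R)%type R (U `*` setT) (fun z => z.2 * h z.1).
  apply: Ck_mul; [exact: openXT|exact: Ck_snd|].
  apply: (Ck_comp (U' := U) (f := fst) (g := h)) => //; first exact: openXT.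
  - by move=> -[? ?] [].
  - exact: Ck_fst.
apply: Ck_eq H; first exact: openXT.
by move=> -[x v] [/= /fh /is_derive_diff[_ ->]].
Qed.

Lemma Ck_expR k (U : set R) : open U -> Ck k U (@expR R).
Proof.
move=> oU; elim: k => [|k IH]; first by move=> x _; exact: continuous_expR.
exact: (Ck_antiderivative oU).
Qed.

Lemma Ck_inv k : Ck k [set x : R | 0 < x] GRing.inv.
Proof.
have oU : open [set x : R | 0 < x] by exact: open_gt.
elim: k => [|k IH].
  by move=> x /= x0; apply: inv_continuous; rewrite gt_eqF.
apply: (@Ck_antiderivative k _ _ (fun x => - (x^-1 * x^-1))) => //.
  move=> x /= x0; have x0' : x != 0 by rewrite gt_eqF.
  apply: (is_derive_eq (@is_deriveV R id x 1 1 x0' _)).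
  by rewrite scaleNr -[_ *: _]/(_ * _) mulr1 -exprVn expr2.
apply: Ck_opp => //; exact: Ck_mul.
Qed.

Lemma Ck_ln k : Ck k [set x : R | 0 < x] (@ln R).
Proof.
have oU : open [set x : R | 0 < x] by exact: open_gt.
case: k => [|k]; first by move=> x /= x0; exact: continuous_ln.
apply: (Ck_antiderivative oU) (Ck_inv k) => x /= x0; exact: is_derive1_ln.
Qed.

End Calculus.

(** * Quadratic forms on finite-dimensional spaces *)

Section FinDim.
Context {R : realType}.
Implicit Types E V : normedModType R.

(** A basis with continuous linear coordinates: it makes bounded closed sets
   compact, expands bilinear forms into finitely many coefficients, and passes
   to products. *)
Definition fincoord E := exists (I : finType) (b : I -> E) (cc : I -> {linear E -> R}),
  (forall i, continuous (cc i)) /\ forall v, v = \sum_i cc i v *: b i.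

Lemma fincoord_R : fincoord (R : normedModType R).
Proof.
exists 'I_1, (fun=> 1), (fun=> idfun); split=> [_ x //|v].
by rewrite big_ord1 /= -[_ *: _]/(_ * _) mulr1.
Qed.

Lemma fincoord_rV n : fincoord ('rV[R]_n : normedModType R).
Proof.
pose cl (j : 'I_n) (v : 'rV[R]_n) := v 0 j.
have cll j : linear_for *%R (cl j) by move=> a u v; rewrite /cl !mxE.
pose clM j := GRing.isLinear.Build R 'rV[R]_n R *%R (cl j) (cll j).
pose clL j : {linear 'rV[R]_n -> R} := HB.pack (cl j) (clM j).
exists 'I_n, (fun j => 'e_j), clL; split=> [j|v]; last exact: row_sum_delta.
exact: coord_continuous.
Qed.

Lemma fincoord_prod E V : fincoord E -> fincoord V ->
  fincoord ((E * V)%type : normedModType R).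
Proof.
move=> [I [b [cc [ccc bE]]]] [J [b' [cc' [ccc' bV]]]].
exists (I + J)%type, (fun s => match s with inl i => (b i, 0) | inr j => (0, b' j) end),
  (fun s => match s with inl i => (cc i \o fst : {linear (E * V)%type -> R})
     | inr j => (cc' j \o snd : {linear (E * V)%type -> R}) end); split.
  move=> [i|j] x /=; apply: continuous_comp; try exact: cvg_fst; try exact: cvg_snd.
    exact: ccc.
  exact: ccc'.
move=> [u v]; rewrite big_sumType /=.
rewrite (eq_bigr (fun i => (cc i u *: b i, 0))); last first.
  by move=> i _; congr (_, _); rewrite scaler0.
rewrite [X in _ + X](eq_bigr (fun j => (0, cc' j v *: b' j))); last first.
  by move=> i _; congr (_, _); rewrite scaler0.
rewrite [LHS](_ : _ = (\sum_i cc i u *: b i, \sum_j cc' j v *: b' j)); last first.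
  by rewrite -bE -bV.
have h1 (r : seq I) (f : I -> E) : \sum_(i <- r) ((f i, 0) : E * V) = (\sum_(i <- r) f i, 0).
  by elim: r => [|i r IH]; rewrite ?big_nil// !big_cons IH; congr (_, _); rewrite addr0.
have h2 (r : seq J) (f : J -> V) : \sum_(i <- r) ((0, f i) : E * V) = (0, \sum_(i <- r) f i).
  by elim: r => [|i r IH]; rewrite ?big_nil// !big_cons IH; congr (_, _); rewrite addr0.
by rewrite h1 h2; congr (_, _); rewrite ?addr0 ?add0r.
Qed.

Lemma coord_bound E (I : finType) (cc : I -> {linear E -> R}) :
  (forall i, continuous (cc i)) ->
  exists2 C : R, 0 < C & forall i v, `|cc i v| <= C * `|v|.
Proof.
move=> ccc.
have /(_ _)/cid2 k i := linear_lipschitz (ccc i).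
exists (1 + \sum_i s2val (k i)).
  apply: (lt_le_trans ltr01); rewrite lerDl; apply: sumr_ge0 => i _.
  exact/ltW/(s2valP (k i)).
move=> i v; apply: (le_trans (s2valP' (k i) v)); apply: ler_wpM2r => //.
rewrite (bigD1 i)//= addrCA lerDl addr_ge0//; apply: sumr_ge0 => j _.
exact/ltW/(s2valP (k j)).
Qed.

(** The coordinates of a bounded set stay in a cube, whose image under the
   continuous map c |-> sum_i c_i b_i is compact. *)
Lemma fincoord_compact E (A : set E) (M : R) : fincoord E -> closed A ->
  (forall x, A x -> `|x| <= M) -> compact A.
Proof.
move=> [I [b [cc [ccc bE]]]] cA AM.
have [C C0 ccC] := coord_bound ccc.
pose Phi (c : 'rV[R]_#|I|) := \sum_(i <- index_enum I) c 0 (enum_rank i) *: b i.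
have Phic : continuous Phi.
  move=> c; suff /(_ c) : Ck 0 setT Phi by apply.
  apply: Ck_sum => [|i d _]; first exact: openT.
  by apply: continuousZr_tmp; exact: (@coord_continuous R 1 #|I| 0 (enum_rank i)).
pose B := \bigcap_(i in [set: 'I_#|I|]) [set c : 'rV[R]_#|I| | `|c 0 i| <= C * M].
have cB : compact B.
  apply: bounded_closed_compact.
    exists (\sum_(j < #|I|) C * M * `|('e_j : 'rV[R]_#|I|) | ); split; first exact: num_real.
    move=> x xM c Bc /=; apply/ltW/(le_lt_trans _ xM).
    rewrite [X in `|X|]row_sum_delta; apply: (le_trans (ler_norm_sum _ _ _)).
    by apply: ler_sum => j _; rewrite normrZ; apply: ler_wpM2r => //; exact: Bc.
  apply: closed_bigI => j _.
  have -> : [set c : 'rV[R]_#|I| | `|c 0 j| <= C * M] =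
    (fun c : 'rV[R]_#|I| => `|c 0 j|) @^-1` [set x | x <= C * M] by [].
  apply: closed_comp; last exact: closed_le.
  move=> c _; apply: continuous_comp; first exact: coord_continuous.
  exact: norm_continuous.
apply: (subclosed_compact cA (continuous_compact (continuous_subspaceT Phic) cB)).
move=> x Ax; exists (\row_j cc (enum_val j) x).
  move=> j _ /=; rewrite mxE; apply: (le_trans (ccC _ _)).
  by apply: ler_wpM2l; [exact: ltW|exact: AM].
by rewrite /Phi [RHS]bE; apply: eq_bigr => i _; rewrite mxE enum_rankK.
Qed.

Lemma bilinear_expand E (I : finType) (b : I -> E) (cc : I -> {linear E -> R})
    (g : E -> E -> R) : (forall v, v = \sum_i cc i v *: b i) ->
  (forall u, scalar (g u)) -> (forall u v, g u v = g v u) ->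
  forall u v, g u v = \sum_i \sum_j cc i u * cc j v * g (b i) (b j).
Proof.
move=> bE gl gs u v.
have ge w (s : seq I) (c : I -> R) :
    g w (\sum_(i <- s) c i *: b i) = \sum_(i <- s) c i * g w (b i).
  elim: s => [|i s IH]; first by rewrite !big_nil; have := gl w (-1) 0 0;
    rewrite scaler0 addr0 mulN1r addNr.
  by rewrite !big_cons gl IH.
rewrite {1}(bE u) gs ge; apply: eq_bigr => i _.
rewrite gs {1}(bE v) ge big_distrr /=; apply: eq_bigr => j _.
by rewrite mulrA.
Qed.

Lemma quad_continuous E (g : E -> E -> R) : fincoord E ->
  (forall u, scalar (g u)) -> (forall u v, g u v = g v u) ->
  continuous (fun v => g v v).
Proof.
move=> [I [b [cc [ccc bE]]]] gl gs.
have Cs : Ck 0 setT (fun v : E => g v v).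
  have -> : (fun v => g v v) = (fun v => \sum_i \sum_j cc i v * cc j v * g (b i) (b j)).
    by apply/funext => v; exact: bilinear_expand.
  do 2 (apply: Ck_sum; [exact: openT|move=> ?]).
  apply: Ck_mul; [exact: openT| |exact: Ck_cst].
  by apply: Ck_mul; [exact: openT|exact: Ck_lin|exact: Ck_lin].
by move=> v; exact: Cs.
Qed.

Lemma sphere_min E (f : E -> R) : fincoord E -> (exists v : E, v != 0) ->
  (forall v, v != 0 -> {for v, continuous f}) ->
  exists2 v : E, `|v| = 1 & forall w, w != 0 -> f v <= f (`|w|^-1 *: w).
Proof.
move=> fE [v0 v0n] fc.
have n1 (w : E) : w != 0 -> `| `|w|^-1 *: w | = 1.
  by move=> w0; rewrite normrZ ger0_norm ?invr_ge0// mulVf// normr_eq0.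
have cS : compact [set v : E | `|v| = 1].
  apply: (@fincoord_compact _ _ 1 fE); last by move=> x /= ->.
  have -> : [set v : E | `|v| = 1] = (Num.norm : E -> R) @^-1` [set 1] by [].
  by apply: closed_comp; [move=> v _; exact: norm_continuous|exact: closed_eq].
have [||v /[!inE] v1 vm] := compact_EVT_min (f := f) _ cS _.
- by exists (`|v0|^-1 *: v0) => /=; exact: n1.
- apply: continuous_in_subspaceT => v /[!inE] /= v1.
  by apply: fc; rewrite -normr_eq0 v1 oner_neq0.
by exists v => // w w1; apply: vm; rewrite inE /= n1.
Qed.

Section FormAlgebra.
Context {E : normedModType R} (g : E -> E -> R).
Hypothesis gl : forall u, scalar (g u).
Hypothesis gs : forall u v, g u v = g v u.

Lemma bformDr u v w : g u (v + w) = g u v + g u w.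
Proof. by have := gl u 1 v w; rewrite scale1r mul1r. Qed.
Lemma bform0r u : g u 0 = 0.
Proof. by apply: (addrI (g u 0)); rewrite -bformDr !addr0. Qed.
Lemma bformZr u a v : g u (a *: v) = a * g u v.
Proof. by have := gl u a v 0; rewrite addr0 bform0r addr0. Qed.
Lemma bformDl u v w : g (v + w) u = g v u + g w u.
Proof. by rewrite !(gs _ u) bformDr. Qed.
Lemma bformZl u a v : g (a *: v) u = a * g v u.
Proof. by rewrite !(gs _ u) bformZr. Qed.
Lemma bformBZl u v a w : g (v - a *: w) u = g v u - a * g w u.
Proof.
have -> : - (a *: w) = (- a) *: w by rewrite scaleNr.
by rewrite bformDl bformZl mulNr.
Qed.

End FormAlgebra.

Section Forms.
Context {E : normedModType R} (fE : fincoord E) (g : E -> E -> R).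
Hypothesis gl : forall u, scalar (g u).
Hypothesis gs : forall u v, g u v = g v u.
Hypothesis gpos : forall u, u != 0 -> 0 < g u u.

Lemma bform_ge0 u : 0 <= g u u.
Proof.
by have [->|/gpos/ltW//] := eqVneq u 0; rewrite (bform0r gl).
Qed.

Lemma bform_cauchy_schwarz u v : g u v ^+ 2 <= g u u * g v v.
Proof.
have [->|v0] := eqVneq v 0; first by rewrite !(bform0r gl) expr0n mulr0.
have := bform_ge0 (g v v *: u + (- g u v) *: v).
rewrite (bformDl gl gs) !(bformDr gl) !(bformZl gl gs) !(bformZr gl) (gs v u) => h.
have := gpos v0; nra.
Qed.

Lemma bform_lower : exists2 m : R, 0 < m & forall v, m * `|v| ^+ 2 <= g v v.
Proof.
have [[v0 v0n]|noE] := pselect (exists v : E, v != 0); last first.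
  exists 1 => // v; have [->|v0] := eqVneq v 0; first by rewrite (bform0r gl) normr0 expr0n mulr0.
  by case: noE; exists v.
have [||v v1 vm] := sphere_min (f := fun v => g v v) fE; first by exists v0.
  by move=> v _; exact: quad_continuous.
have vn0 : v != 0 by rewrite -normr_eq0 v1 oner_neq0.
exists (g v v); first exact: gpos.
move=> w; have [->|w0] := eqVneq w 0; first by rewrite (bform0r gl) normr0 expr0n mulr0.
have nw0 : `|w| != 0 by rewrite normr_eq0.
have := vm w w0.
by rewrite (bformZl gl gs) (bformZr gl) mulrA -expr2 exprVn mulrC ler_pdivlMr ?exprn_gt0// normr_gt0.
Qed.

(** The minimum of the Rayleigh quotient h(v,v)/g(v,v) is attained, and at a
   minimiser v0 the positive semidefinite form h - mu g vanishes, hence so do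
   all its values (v0, w). *)
Lemma rayleigh (h : E -> E -> R) : (exists v : E, v != 0) ->
  (forall u, scalar (h u)) -> (forall u v, h u v = h v u) ->
  exists mu v0, [/\ v0 != 0, forall w, h v0 w = mu * g v0 w &
    forall v, mu * g v v <= h v v].
Proof.
move=> nE hl hs.
have gc := quad_continuous fE gl gs; have hc := quad_continuous fE hl hs.
pose f v := h v v / g v v.
have hZ a v : h (a *: v) (a *: v) = a ^+ 2 * h v v.
  by rewrite (bformZl hl hs) (bformZr hl) mulrA -expr2.
have gZ a v : g (a *: v) (a *: v) = a ^+ 2 * g v v.
  by rewrite (bformZl gl gs) (bformZr gl) mulrA -expr2.
have [|v v1 vm] := sphere_min (f := f) fE nE.
  move=> v vn0; apply: (@cvgM _ _ _ _ (fun v => h v v)); first exact: hc.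
  by apply: cvgV; [rewrite gt_eqF// gpos|exact: gc].
have vn0 : v != 0 by rewrite -normr_eq0 v1 oner_neq0.
pose mu := f v; have gv := gpos vn0.
have hmu w : mu * g w w <= h w w.
  have [->|w0] := eqVneq w 0.
    by rewrite (bform0r gl) (bform0r hl) mulr0.
  have := vm w w0.
  rewrite /f hZ gZ -/(f v) -/mu -mulf_div divff ?mul1r ?ler_pdivlMr ?gpos//.
  by rewrite expf_neq0// invr_eq0 normr_eq0.
exists mu, v; split=> // w.
have hv : h v v = mu * g v v by rewrite /mu /f mulfVK// gt_eqF.
pose a := h v w - mu * g v w; pose c := h w w - mu * g w w.
have c0 : 0 <= c by rewrite subr_ge0 hmu.
have key t : 0 <= 2 * t * a + t ^+ 2 * c.
  have := hmu (v + t *: w).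
  rewrite (bformDl hl hs) !(bformDr hl) (bformDl gl gs) !(bformDr gl) hZ gZ.
  rewrite !(bformZl hl hs) !(bformZr hl) !(bformZl gl gs) !(bformZr gl) (gs w v) (hs w v).
  rewrite hv /a /c; nra.
(* A quadratic 2 t a + t^2 c that is nonnegative at t = - a / (c + 1) has a = 0,
   as c is nonnegative. *)
have c1 : 0 < c + 1 by lra.
have := key (- (a / (c + 1))).
set s := a / (c + 1); have sE : a = s * (c + 1) by rewrite /s mulfVK// gt_eqF.
move=> ks; apply/eqP; rewrite -subr_eq0 -/a sE mulf_eq0; apply/orP; left.
rewrite -sqrf_eq0 eq_le sqr_ge0 andbT; move: ks; rewrite sE.
have := sqr_ge0 s; nra.
Qed.

End Forms.

(** At x itself the bounds hold by compactness of the unit sphere. Nearby, the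
   finitely many coefficients move by less than e, which changes the value at v
   by at most e (N C |v|)^2. *)
Lemma bform_near_bounds (T : topologicalType) E (x : T) (g : T -> E -> E -> R) :
  fincoord E ->
  (\near x, (forall u, scalar (g x u)) /\ (forall u v, g x u v = g x v u)) ->
  (forall u, u != 0 -> 0 < g x u u) ->
  (forall u v, {for x, continuous (fun y => g y u v)}) ->
  exists m M : R, [/\ 0 < m, 0 < M & \forall y \near x, forall v,
     m ^+ 2 * `|v| ^+ 2 <= g y v v /\ g y v v <= M ^+ 2 * `|v| ^+ 2].
Proof.
move=> fE gls gpos gc.
have [gl gs] := nbhs_singleton gls.
have [m m0 mP] := bform_lower fE gl gs gpos.
have [I [b [cc [ccc bE]]]] := fE.
have [C C0 ccC] := coord_bound ccc.
pose N : R := #|I|%:R; have N0 : 0 <= N by rewrite ler0n.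
(* Chosen so that the total change stays below (m / 2) |v|^2. *)
pose e : R := m / (2 * (1 + N * N * C ^+ 2)).
have D0 : 0 < 1 + N * N * C ^+ 2 by rewrite ltr_wpDr// mulr_ge0 ?sqr_ge0// mulr_ge0.
have e0 : 0 < e by rewrite divr_gt0// mulr_gt0.
have dlt y (d : R) : ((forall u, scalar (g y u)) /\ (forall u v, g y u v = g y v u)) ->
   0 <= d ->
   (forall i j, `|g y (b i) (b j) - g x (b i) (b j)| <= d) ->
   forall v, `|g y v v - g x v v| <= N * N * C ^+ 2 * d * `|v| ^+ 2.
  move=> [yl ys] d0 h v; rewrite (bilinear_expand bE yl ys) (bilinear_expand bE gl gs).
  rewrite -sumrB; apply: (le_trans (ler_norm_sum _ _ _)).
  have -> : N * N * C ^+ 2 * d * `|v| ^+ 2 =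
      \sum_(i : I) \sum_(j : I) (C * `|v| * (C * `|v|) * d).
    rewrite !sumr_const -mulrnA -[in RHS]mulr_natl natrM -/N; ring.
  apply: ler_sum => i _; rewrite -sumrB; apply: (le_trans (ler_norm_sum _ _ _)).
  apply: ler_sum => j _; rewrite -mulrBr normrM normrM.
  by apply: ler_pM => //; rewrite ?mulr_ge0//; apply: ler_pM.
have [M M0 MP] : exists2 M : R, 0 < M & forall v, g x v v <= M * `|v| ^+ 2.
  pose d := \sum_i \sum_j `|g x (b i) (b j)|.
  have d0 : 0 <= d by do 2 (apply: sumr_ge0 => ? _).
  exists (1 + N * N * C ^+ 2 * d); first by rewrite ltr_wpDr// mulr_ge0// mulr_ge0 ?sqr_ge0// mulr_ge0.
  move=> v; rewrite (bilinear_expand bE gl gs).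
  have -> : (1 + N * N * C ^+ 2 * d) * `|v| ^+ 2 = `|v| ^+ 2 +
      \sum_(i : I) \sum_(j : I) (C * `|v| * (C * `|v|) * d).
    rewrite !sumr_const -mulrnA -[X in _ = _ + X]mulr_natl natrM -/N; ring.
  rewrite -[X in X <= _]add0r; apply: lerD; first exact: sqr_ge0.
  apply: ler_sum => i _; apply: ler_sum => j _; apply: (le_trans (ler_norm _)).
  rewrite normrM normrM; apply: ler_pM => //; first by apply: ler_pM.
  rewrite /d (bigD1 i)//= (bigD1 j)//= -addrA lerDl addr_ge0//.
    by apply: sumr_ge0.
  by apply: sumr_ge0 => ? _; apply: sumr_ge0.
exists (Num.sqrt (m / 2)), (Num.sqrt (M + m)); split.
- by rewrite sqrtr_gt0 divr_gt0.
- by rewrite sqrtr_gt0 addr_gt0.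
have near1 : \forall y \near x, forall i j, `|g y (b i) (b j) - g x (b i) (b j)| < e.
  apply: filter_forall => i; apply: filter_forall => j.
  have /cvgrPdist_lt /(_ e e0) := gc (b i) (b j).
  by apply: filterS => y; rewrite distrC.
near=> y; move=> v.
have yls : (forall u, scalar (g y u)) /\ (forall u v, g y u v = g y v u) by near: y.
have near1y : forall i j, `|g y (b i) (b j) - g x (b i) (b j)| < e by near: y.
have := dlt y e yls (ltW e0) (fun i j => ltW (near1y i j)) v.
have ee : N * N * C ^+ 2 * e <= m / 2.
  rewrite /e mulrA ler_pdivrMr ?mulr_gt0//.
  have -> : m / 2 * (2 * (1 + N * N * C ^+ 2)) = m * (1 + N * N * C ^+ 2) by field.
  by rewrite [leLHS]mulrC ler_pM2l// lerDr.
have := sqr_ge0 `|v|; set w := `|v| ^+ 2 => w0; rewrite ler_norml => /andP[h1 h2].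
have := mP v; have := MP v; rewrite -/w => hM hm.
have hw := ler_wpM2r w0 ee; have mw : 0 <= m * w by rewrite mulr_ge0// ltW.
have -> : Num.sqrt (m / 2) ^+ 2 = m / 2 by rewrite sqr_sqrtr// divr_ge0 ?ltW.
have -> : Num.sqrt (M + m) ^+ 2 = M + m by rewrite sqr_sqrtr// addr_ge0 ?ltW.
rewrite (mulrDl M) (mulrAC m); rewrite (mulrAC m) in hw; split; lra.
Unshelve. all: by end_near. Qed.

End FinDim.

(** * Open submanifolds and products with the line *)

Section Topology.

Lemma hausdorff_prod (T1 T2 : topologicalType) : hausdorff_space T1 ->
  hausdorff_space T2 -> hausdorff_space (T1 * T2)%type.
Proof.
move=> h1 h2 [p1 p2] [q1 q2] pq; congr (_, _).
  apply: h1 => A B Ap Bq.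
  have [||[x y] [/= ? ?]] := pq (fst @^-1` A) (fst @^-1` B).
  - exact: cvg_fst Ap.
  - exact: cvg_fst Bq.
  by exists x.
apply: h2 => A B Ap Bq.
have [||[x y] [/= ? ?]] := pq (snd @^-1` A) (snd @^-1` B).
- exact: cvg_snd Ap.
- exact: cvg_snd Bq.
by exists y.
Qed.

Lemma openX_prod (T1 T2 : topologicalType) (A : set T1) (B : set T2) :
  open A -> open B -> open (A `*` B).
Proof.
move=> oA oB; rewrite openE => -[x y] [/= Ax By].
by exists (A, B) => //; split; exact: open_nbhs_nbhs.
Qed.

Lemma continuous_pair_at (T T1 T2 : topologicalType) (f : T -> T1) (g : T -> T2) x :
  {for x, continuous f} -> {for x, continuous g} ->
  {for x, continuous (fun y => (f y, g y))}.
Proof. by move=> cf cg; apply: (cvg_pair cf cg). Qed.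

Lemma second_countable_prod (T1 T2 : topologicalType) :
  @second_countable T1 -> @second_countable T2 -> @second_countable (T1 * T2)%type.
Proof.
move=> [B1 c1 [ ob1 b1]] [B2 c2 [ ob2 b2]].
exists [set P.1 `*` P.2 | P in B1 `*` B2].
  exact: sub_countable (card_image_le _ _) (countableX c1 c2).
split; first by move=> _ [[P Q] [/= /ob1 oP /ob2 oQ] <-]; exact: openX_prod.
move=> [x y] U [[V W] [/= Vx Wy] VWU].
have [P [BP PPx] PV] := b1 x _ Vx; have [Q [BQ Qy] QW] := b2 y _ Wy.
exists (P `*` Q); first by split; [exists (P, Q)|].
by move=> [x' y'] [/= /PV ? /QW ?]; apply: VWU.
Qed.

Lemma second_countable_R (R : realType) : @second_countable R.
Proof.
pose f (q : rat * rat) : set R := [set` `]ratr q.1, ratr q.2[].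
exists [set f q | q in setT].
  exact: sub_countable (card_image_le _ _) (countableP _).
split; first by move=> _ [q _ <-]; exact: interval_open.
move=> x U [e /= e0 eU].
have /rat_in_itvoo[q] : x - e < x by rewrite ltrBlDr ltrDl.
rewrite in_itv/= => /andP[q1 q2].
have /rat_in_itvoo[r] : x < x + e by rewrite ltrDl.
rewrite in_itv/= => /andP[r1 r2].
exists (f (q, r)).
  by split; [exists (q, r)|rewrite /f /= in_itv/= q2 r1].
move=> y; rewrite /f /= in_itv/= => /andP[y1 y2]; apply: eU => /=.
rewrite ltr_norml; apply/andP; split; lra.
Qed.

End Topology.

Section Atlases.
Context {R : realType}.

Section OneAtlas.
Context {E : normedModType R} (A : atlas E) (mA : manifold A).

Lemma open_fwd_image (i : ix A) (O : set (pt A)) : open O ->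
  open (fwd i @` (dom i `&` O)).
Proof.
move=> oO.
have -> : fwd i @` (dom i `&` O) = img i `&` bwd i @^-1` O.
  apply/seteqP; split=> x.
    by move=> [p [dp Op] <-]; split; [exists p|rewrite /= fwdK].
  by move=> [[p dp <-]] /=; rewrite fwdK// => Op; exists p.
rewrite openE => x [ix Ox]; apply: filterI.
  by apply: open_nbhs_nbhs; split=> //; exact: img_open.
by apply: (bwd_continuous mA ix); apply: open_nbhs_nbhs.
Qed.

Lemma img_bwd (i : ix A) x : img i x -> dom i (bwd i x).
Proof. by move=> [p dp <-]; rewrite fwdK. Qed.

Lemma bwdK (i : ix A) x : img i x -> fwd i (bwd i x) = x.
Proof. by move=> [p dp <-]; rewrite fwdK. Qed.

Lemma trans_fwd (i j : ix A) p : dom i p -> trans i j (fwd i p) = fwd j p.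
Proof. by move=> dp; rewrite /trans /= fwdK. Qed.

Lemma open_dom2 (i j : ix A) : open (fwd i @` (dom i `&` dom j)).
Proof. by apply: open_fwd_image; exact: dom_open. Qed.

Lemma trans_differentiable (i j : ix A) x :
  (fwd i @` (dom i `&` dom j)) x -> differentiable (trans i j) x.
Proof. by move=> h; have [+ _] := trans_smooth mA i j 1; apply. Qed.

Lemma restrict_manifold (O : set (pt A)) : open O -> manifold (Defs.restrict O).
Proof.
move=> oO; split.
- exact: (model_findim mA).
- exact: (mfd_hausdorff mA).
- exact: (mfd_second_countable mA).
- by move=> i; apply: openI => //; exact: (dom_open mA).
- by move=> i; exact: open_fwd_image.
- by move=> i p [dp _]; exact: (fwdK mA dp).
- by move=> i p [dp _]; exact: (fwd_continuous mA dp).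
- by move=> i x [p [dp _] <-]; apply: (bwd_continuous mA); exists p.
- move=> i j k; apply: Ck_sub (trans_smooth mA i j k).
  by move=> _ [p [[? ?] [? ?]] <-]; exists p.
Qed.

End OneAtlas.

Section LineProd.
Context {E : normedModType R} (A : atlas E) (mA : manifold A).
Local Notation L := (line_prod A).

Lemma line_img (i : ix A) : @img R _ L i = setT `*` img i.
Proof.
apply/seteqP; split=> [_ [p dp <-]|[s x] [/= _ [q dq <-]]]; last by exists (s, q).
by split=> //=; exists p.2.
Qed.

Lemma line_img2 (i j : ix A) :
  @fwd R _ L i @` (@dom R _ L i `&` @dom R _ L j) = setT `*` (fwd i @` (dom i `&` dom j)).
Proof.
apply/seteqP; split=> [_ [p [di dj] <-]|[s x] [/= _ [q [di dj] <-]]].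
  by split=> //=; exists p.2.
by exists (s, q).
Qed.

Lemma line_model : exists k (b : 'I_k -> (R * E)%type),
    forall v, exists c : 'I_k -> R, v = \sum_l c l *: b l.
Proof.
have [k [b bE]] := model_findim mA.
exists k.+1, (fun l => match unlift ord0 l with Some m => (0, b m) | None => (1, 0) end).
move=> [s v]; have [c ->] := bE v.
exists (fun l => match unlift ord0 l with Some m => c m | None => s end).
rewrite big_ord_recl unlift_none (eq_bigr (fun l => (0, c l *: b l))); last first.
  by move=> l _; rewrite liftK; congr (_, _); rewrite scaler0.
have h (r : seq 'I_k) (f : 'I_k -> E) :
    \sum_(i <- r) ((0, f i) : R * E) = (0, \sum_(i <- r) f i).
  by elim: r => [|i r IH]; rewrite ?big_nil// !big_cons IH; congr (_, _); rewrite addr0.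
by rewrite h; congr (_, _); rewrite /= ?scaler0 ?add0r// addr0 -[_ *: _]/(_ * _) mulr1.
Qed.

Lemma openTX (U : set E) : open U -> @open (R * E)%type ([set: R] `*` U).
Proof. by move=> oU; apply: openX_prod => //; exact: openT. Qed.

Lemma line_manifold : manifold L.
Proof.
split.
- exact: line_model.
- by apply: hausdorff_prod; [exact: Rhausdorff|exact: mfd_hausdorff].
- by apply: second_countable_prod;
    [exact: second_countable_R|exact: mfd_second_countable].
- move=> i; apply: (@open_comp _ _ snd (dom (i : ix A))); last exact: dom_open.
  by move=> p _; exact: cvg_snd.
- by move=> i; rewrite line_img; apply: openTX; exact: img_open.
- by move=> i [s p] /= dp; rewrite fwdK.
- move=> i [s p] /= dp; apply: continuous_pair_at; first exact: cvg_fst.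
  apply: (@continuous_comp _ _ _ snd (fwd (i : ix A))); first exact: cvg_snd.
  exact: (fwd_continuous mA dp).
- move=> i [s x] /=; rewrite line_img => -[/= _ ix].
  apply: continuous_pair_at; first exact: cvg_fst.
  apply: (@continuous_comp _ _ _ snd (bwd (a := A) i)); first exact: cvg_snd.
  exact: (bwd_continuous mA ix).
- move=> i j k; rewrite line_img2.
  have o2 := openTX (open_dom2 mA i j).
  apply: (@Ck_pair R k (R * E)%type R E _ fst (trans (A := A) i j \o snd)) => //.
    exact: Ck_fst.
  apply: (Ck_comp o2 (open_dom2 mA i j)) (trans_smooth mA i j k).
  - by move=> -[? ?] [].
  - exact: Ck_snd.
Qed.

End LineProd.

Lemma diff_prodmap (E1 E2 V1 V2 : normedModType R) (f : E1 -> V1) (g : E2 -> V2)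
    (x : E1 * E2) : differentiable f x.1 -> differentiable g x.2 ->
  @differentiable_def R (E1 * E2)%type (V1 * V2)%type
    (fun y => (f y.1, g y.2)) (nbhs x) (Phantom _ (nbhs x)) /\
  forall u : E1 * E2, 'd (fun y : E1 * E2 => (f y.1, g y.2)) x u =
    ('d f (x.1) (u.1), 'd g (x.2) (u.2)).
Proof.
move=> df dg.
have d1 : differentiable (fst : E1 * E2 -> E1) x.
  by apply: linear_differentiable => z; exact: cvg_fst.
have d2 : differentiable (snd : E1 * E2 -> E2) x.
  by apply: linear_differentiable => z; exact: cvg_snd.
have df' : differentiable (f \o fst : E1 * E2 -> V1) x by exact: differentiable_comp.
have dg' : differentiable (g \o snd : E1 * E2 -> V2) x by exact: differentiable_comp.
split; first exact: (differentiable_pair df' dg').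
move=> u; have -> := diff_pair df' dg'.
rewrite (diff_comp d1 df) (diff_comp d2 dg) /=.
rewrite (@diff_lin R (E1 * E2)%type E1 fst); last by move=> z; exact: cvg_fst.
by rewrite (@diff_lin R (E1 * E2)%type E2 snd); last by move=> z; exact: cvg_snd.
Qed.

Lemma diff_line_trans (E : normedModType R) (A : atlas E) (mA : manifold A)
    (i j : ix A) (x u : R * E) : (fwd i @` (dom i `&` dom j)) x.2 ->
  'd (@trans R _ (line_prod A) i j) x u = (u.1, 'd (trans i j) (x.2) (u.2)).
Proof.
move=> xij.
have [|_ ->] := @diff_prodmap R E R E id (trans i j) x _ (trans_differentiable mA xij).
  by apply: (@linear_differentiable _ _ _ idfun) => z.
by rewrite (@diff_lin R R R idfun) => // z.
Qed.

End Atlases.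

(** * Pulled-back metrics and warped products *)

Section Metrics.
Context {R : realType}.

Lemma Ck_scalec k (E' E : normedModType R) (U : set E') (f : E' -> R) (b : E) :
  open U -> Ck k U f -> Ck k U (fun z => f z *: b).
Proof.
move=> oU Cf.
have lb : linear ( *:%R ^~ b : R -> E) by move=> u y z; rewrite scalerDl scalerA.
pose bM := GRing.isLinear.Build _ _ _ _ _ lb.
pose bL : {linear R -> E} := HB.pack ( *:%R ^~ b : R -> E) bM.
apply: (@Ck_comp _ k _ _ _ U setT f bL) => //; first exact: openT.
by apply: Ck_lin => x; exact: scalel_continuous.
Qed.

Context {E : normedModType R} (A : atlas E) (mA : manifold A) (fE : fincoord E).
Implicit Types (g : bilin_field A) (H B : endo_field A).

(** A metric field is only given to be smooth for constant arguments; its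
   expansion in coordinates extends this to arguments that vary with the
   point. *)
Lemma Ck_metric g k (E' : normedModType R) (U : set E') (i : ix A)
    (pi X Y : E' -> E) : metric_field g -> open U ->
  (forall z, U z -> img i (pi z)) -> Ck k U pi -> Ck k U X -> Ck k U Y ->
  Ck k U (fun z => g i (pi z) (X z) (Y z)).
Proof.
move=> [gl gs gsm _] oU Upi Cpi CX CY.
have [I [b [cc [ccc bE]]]] := fE.
have Ccc (Z : E' -> E) l : Ck k U Z -> Ck k U (cc l \o Z).
  move=> CZ; apply: (Ck_comp oU openT) CZ _ => //; exact: Ck_lin.
have H : Ck k U (fun z => \sum_l \sum_m cc l (X z) * cc m (Y z) * g i (pi z) (b l) (b m)).
  apply: Ck_sum => // l; apply: Ck_sum => // m.
  apply: Ck_mul => //; first by apply: Ck_mul => //; exact: Ccc.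
  exact: (Ck_comp oU (img_open mA i) Upi Cpi (gsm i (b l) (b m) k)).
apply: Ck_eq H => // z Uz; symmetry; apply: bilinear_expand => //.
- by move=> u; apply: gl; exact: Upi.
- by move=> u v; apply: gs; exact: Upi.
Qed.

(** The slice of the cylinder at time t carries pull_metric g (shift_endo H t),
   for g the warped metric. *)
Definition shift_endo H (t : R) : endo_field A := fun i x w => H i x w - (2 * t) *: w.

Definition pull_metric g B : bilin_field A := fun i x u v => g i x (B i x u) (B i x v).

Lemma shift_smooth_endo H t : smooth_endo H -> smooth_endo (shift_endo H t).
Proof.
move=> [Hl Hs Ht]; split.
- move=> i x ix a u v; rewrite /shift_endo Hl// scalerBr !scalerDr !scalerA.
  by rewrite opprD addrACA (mulrC a).
- move=> i u k; apply: Ck_add; [exact: img_open|exact: Hs|exact: Ck_cst].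
- move=> i j x u xij; rewrite /shift_endo linearB linearZ /= Ht//.
Qed.

Lemma pull_metric_field g B : metric_field g -> smooth_endo B ->
  metric_field (pull_metric g B).
Proof.
move=> mg [Bl Bs Bt]; have [gl gs gsm gt] := mg; split.
- move=> i x u ix a v w; rewrite /pull_metric Bl//; exact: gl.
- by move=> i x u v ix; apply: gs.
- move=> i u v k; apply: (Ck_metric mg) => //; first exact: img_open.
  + exact: Ck_id.
  + exact: Bs.
  + exact: Bs.
- by move=> i j x u v xij; rewrite /pull_metric (gt i j)// !Bt.
Qed.

Lemma pull_riemannian g B : riemannian g -> smooth_endo B ->
  (forall i x u, img i x -> u != 0 -> B i x u != 0) ->
  riemannian (pull_metric g B).
Proof.
move=> [mg gpos] sB B0; split; first exact: pull_metric_field.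
by move=> i x u ix u0; apply: gpos => //; exact: B0.
Qed.

Section Eigen.
Variables (g : bilin_field A) (H : endo_field A) (beta : R).
Hypothesis rg : riemannian g.
Hypothesis sH : smooth_endo H.
Hypothesis Hsym : forall i x u v, img i x -> g i x (H i x u) v = g i x u (H i x v).
Hypothesis nE : exists v : E, v != 0.

(** The minimum of the Rayleigh quotient is an eigenvalue. This turns bounds on
   the spectrum into bounds on the quadratic form, and provides an eigenvalue
   in the first place. *)
Lemma rayleigh_endo i x : img i x -> exists2 mu, eigenvalues H mu &
  forall v, mu * g i x v v <= g i x (H i x v) v.
Proof.
move=> ix; have [[gl gs _ _] gpos] := rg; have [Hl _ _] := sH.
have gl' u : scalar (g i x u) by exact: gl.
have gs' u v : g i x u v = g i x v u by exact: gs.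
have gpos' u : u != 0 -> 0 < g i x u u by exact: gpos.
have hl u : scalar (fun v => g i x (H i x u) v) by [].
have [|mu [v [v0 hv hmu]]] := rayleigh fE gl' gs' gpos' nE hl.
  by move=> u v; rewrite Hsym// gs'.
exists mu => //; exists i, x, v; split=> //.
apply/eqP; rewrite -subr_eq0; apply/negPn/negP => /gpos'.
set w := H i x v - mu *: v => w0.
suff : g i x w w = 0 by move=> ww; rewrite ww ltxx in w0.
rewrite {1}/w (bformBZl gl' gs') hv.
exact: subrr.
Qed.

Hypothesis Hbeta : forall l, eigenvalues H l -> beta <= l.

Lemma shift_endo_lower i x t v : img i x -> (beta - 2 * t) * g i x v v <= g i x (shift_endo H t i x v) v.
Proof.
move=> ix; have [[gl gs _ _] gpos] := rg.
have gl' u : scalar (g i x u) by exact: gl.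
have gs' u w : g i x u w = g i x w u by exact: gs.
have gv := bform_ge0 gl' (fun u => gpos i x u ix) v.
have [mu emu hmu] := rayleigh_endo ix.
rewrite /shift_endo (bformBZl gl' gs').
by rewrite mulrBl lerD2r; apply: le_trans (hmu v); apply: ler_wpM2r => //; exact: Hbeta.
Qed.

(** With B = H - 2t, Cauchy-Schwarz turns (beta - 2t) |v|^2 <= g(Bv, v) into
   (beta - 2t) |v| <= |Bv|. *)
Lemma shift_metric_lower i x t v : img i x -> 2 * t < beta ->
  (beta - 2 * t) ^+ 2 * g i x v v <= pull_metric g (shift_endo H t) i x v v.
Proof.
move=> ix tb; have [[gl gs _ _] gpos] := rg.
have gl' u : scalar (g i x u) by exact: gl.
have gs' u w : g i x u w = g i x w u by exact: gs.
have gpos' u : u != 0 -> 0 < g i x u u by exact: gpos.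
have [->|v0] := eqVneq v 0.
  by rewrite (bform0r gl') mulr0; exact: (bform_ge0 gl' gpos').
have gv := gpos' _ v0.
rewrite /pull_metric; set w := shift_endo H t i x v.
have h1 : (beta - 2 * t) * g i x v v <= g i x w v by exact: shift_endo_lower.
have h2 : g i x w v ^+ 2 <= g i x w w * g i x v v by exact: bform_cauchy_schwarz.
set c := beta - 2 * t in h1 *; have c0 : 0 < c by rewrite subr_gt0.
rewrite -(ler_pM2r gv); apply: le_trans h2.
have cG : 0 <= c * g i x v v by rewrite mulr_ge0// ltW.
by rewrite -mulrA -expr2 -exprMn ler_sqr// nnegrE// (le_trans cG).
Qed.

Lemma shift_neq0 i x t v : img i x -> 2 * t < beta -> v != 0 ->
  shift_endo H t i x v != 0.
Proof.
move=> ix tb v0; have [[gl gs _ _] gpos] := rg.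
have gl' u : scalar (g i x u) by exact: gl.
apply/eqP => e; have := shift_metric_lower v ix tb.
rewrite /pull_metric e (bform0r gl') leNgt mulr_gt0//; last exact: gpos.
by rewrite exprn_gt0// subr_gt0.
Qed.

Lemma shift_riemannian t : 2 * t < beta -> riemannian (pull_metric g (shift_endo H t)).
Proof.
move=> tb; apply: pull_riemannian => //; first exact: shift_smooth_endo.
by move=> i x u ix u0; exact: shift_neq0.
Qed.

End Eigen.

Lemma shift_metric_Ck g H k (E' : normedModType R) (U : set E') (i : ix A) (tau : E' -> R)
    (pi : E' -> E) u v : metric_field g -> smooth_endo H -> open U ->
  (forall z, U z -> img i (pi z)) -> Ck k U tau -> Ck k U pi ->
  Ck k U (fun z => pull_metric g (shift_endo H (tau z)) i (pi z) u v).
Proof.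
move=> mg [_ Hs _] oU Upi Ctau Cpi.
have CH w : Ck k U (fun z => shift_endo H (tau z) i (pi z) w).
  apply: Ck_add => //.
    exact: (Ck_comp oU (img_open mA i) Upi Cpi (Hs i w k)).
  have : Ck k U (fun z => (-2 * tau z) *: w).
    by apply: Ck_scalec => //; apply: Ck_mul => //; exact: Ck_cst.
  by apply: Ck_eq => // z _; rewrite mulNr scaleNr.
exact: Ck_metric.
Qed.

End Metrics.

Section Warped.
Context {R : realType} {E : normedModType R} (F : atlas E) (mF : manifold F).
Variable gF : bilin_field F.
Hypothesis rF : riemannian gF.
Hypothesis fE : fincoord E.

Lemma warped_riemannian : riemannian (warped_metric gF).
Proof.
have [mg gpos] := rF; have [gl gs gsm gt] := mg; split; last first.
  move=> i [s x] [u1 u2]; rewrite line_img => -[/= _ ix] u0; rewrite /warped_metric /=.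
  have e0 := expR_gt0 (- 4 * s).
  have [u20|u20] := eqVneq u2 0.
    have u10 : u1 != 0 by apply: contra_neq u0 => ->; rewrite u20.
    rewrite u20 (bform0r (fun u => gl i x u ix)) mulr0 addr0 -expr2.
    by rewrite exprn_even_gt0.
  by have := gpos i x u2 ix u20; rewrite -expr2; have := sqr_ge0 u1; nra.
split.
- move=> i [s x] [u1 u2]; rewrite line_img => -[/= _ ix] a [v1 v2] [w1 w2].
  rewrite /warped_metric /= gl// -[a *: v1]/(a * v1).
  by rewrite !mulrDr addrACA (mulrCA u1) (mulrCA (expR _)).
- move=> i [s x] [u1 u2] [v1 v2]; rewrite line_img => -[/= _ ix].
  by rewrite /warped_metric /= mulrC gs.
- move=> i u v k; rewrite line_img /warped_metric.
  have oU := openTX (img_open mF i).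
  apply: Ck_add => //; first exact: Ck_cst.
  apply: Ck_mul => //.
    apply: (@Ck_comp _ k _ _ _ _ setT (fun x : R * E => - 4 * x.1) expR) => //.
    + exact: openT.
    + by apply: Ck_mul => //; [exact: Ck_cst|exact: Ck_fst].
    + by apply: Ck_expR; exact: openT.
  apply: (@Ck_comp _ k _ _ _ _ (@img R E F i) snd (fun x => gF i x u.2 v.2)) => //.
  + exact: img_open.
  + by move=> -[? ?] [].
  + exact: Ck_snd.
  + exact: gsm.
- move=> i j [s x] [u1 u2] [v1 v2]; rewrite line_img2 => -[/= _ xij].
  rewrite /warped_metric !(diff_line_trans mF)//=.
  by rewrite (gt i j).
Qed.

End Warped.

(** * Functions of one variable, curves and arc length *)

Section RealLine.
Context {R : realType}.
Implicit Types E V : normedModType R.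

Lemma derive1_diff_comp E V (f : R -> E) (h : E -> V) (t : R) :
  derivable f t 1 -> differentiable h (f t) ->
  derivable (h \o f) t 1 /\ derive1 (h \o f) t = 'd h (f t) (derive1 f t).
Proof.
move=> /derivable1_diffP df dh.
have dhf : differentiable (h \o f) t by exact: differentiable_comp.
by split; [exact/derivable1_diffP|rewrite (derive1E' df) (derive1E' dhf) diff_comp].
Qed.

Lemma derive1_near_eq E (f g : R -> E) (t : R) : (\near t, f t = g t) ->
  derivable f t 1 -> derivable g t 1 /\ derive1 g t = derive1 f t.
Proof.
move=> fg /derivable1_diffP df; have [dg dE] := diff_near_eq fg df.
by split; [exact/derivable1_diffP|rewrite (derive1E' df) (derive1E' dg) dE].
Qed.

Lemma is_derive_derive1 E (f : R -> E) (t : R) v : is_derive t 1 f v -> derive1 f t = v.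
Proof. by move=> h; rewrite derive1E derive_val. Qed.

Lemma real_induction (P : R -> Prop) : P 0 ->
  (forall t, 0 <= t < 1 -> (forall s, 0 <= s <= t -> P s) ->
    exists2 d : R, 0 < d & forall s, t < s < t + d -> P s) ->
  (forall t, 0 < t <= 1 -> (forall s, 0 <= s < t -> P s) -> P t) ->
  forall t, 0 <= t <= 1 -> P t.
Proof.
move=> P0 Pr Pl.
pose S := [set t : R | 0 <= t <= 1 /\ forall s, 0 <= s <= t -> P s].
have S0 : S 0.
  split; first by rewrite lexx ler01.
  by move=> s; rewrite -eq_le => /eqP <-.
have hS : has_sup S by split; [exists 0|exists 1 => t [/andP[]]].
have mE : forall s, 0 <= s < sup S -> P s.
  move=> s /andP[s0 sm]; have /(sup_adherent)/(_ hS)[t St] : 0 < sup S - s by rewrite subr_gt0.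
  by rewrite subKr => st; apply: St.2; rewrite s0 ltW.
have m0 : 0 <= sup S by apply: ub_le_sup => //; case: hS.
have m1 : sup S <= 1 by apply: ge_sup; [exists 0|move=> t [/andP[]]].
have Pm : P (sup S).
  have [<-//|mn0] := eqVneq 0 (sup S).
  by apply: Pl => //; rewrite m1 lt_neqAle mn0 m0.
have Sm : S (sup S).
  split; first by rewrite m0.
  move=> s /andP[s0]; rewrite le_eqVlt => /orP[/eqP ->//|sm].
  by apply: mE; rewrite s0.
suff m1E : sup S = 1 by move=> t; rewrite -m1E => /Sm.2.
apply/eqP; rewrite eq_le m1 leNgt; apply/negP => mlt.
have [|d d0 dP] := Pr (sup S) _ Sm.2; first by rewrite m0.
pose s := Num.min 1 (sup S + d / 2).
have sm : sup S < s by rewrite lt_min mlt ltrDl divr_gt0.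
have : S s.
  split; first by rewrite ge_min lexx/= andbT ltW// (le_lt_trans m0).
  move=> u /andP[u0 us]; have [um|mu] := leP u (sup S); first by apply: Sm.2; rewrite u0.
  apply: dP; rewrite mu/=; apply: (le_lt_trans us); rewrite gt_min; apply/orP; right.
  by rewrite ltrD2l ltr_pdivrMr// mulr_natr mulr2n ltrDl.
by move=> Ss; have := ub_le_sup hS.2 Ss; rewrite leNgt sm.
Qed.

Lemma closed_left (T : topologicalType) (f : R -> T) (C : set T) (t : R) :
  {for t, continuous f} -> closed C -> 0 < t -> (forall s, 0 <= s < t -> C (f s)) -> C (f t).
Proof.
move=> fc cC t0 fC; apply: contrapT => nC.
have : nbhs (f t) (~` C) by apply: open_nbhs_nbhs; split=> //; exact: closed_openC.
move=> /fc [e /= e0 eC].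
pose s := Num.max 0 (t - e / 2).
have e2 : 0 < e / 2 by rewrite divr_gt0.
have st : s < t by rewrite gt_max t0 ltrBlDr ltrDl.
apply: (eC s); last by apply: fC; rewrite st le_max lexx.
rewrite /= gtr0_norm ?subr_gt0// ltrBlDr -ltrBlDl; apply: lt_le_trans (_ : t - e / 2 <= _).
  by rewrite ltrD2l ltrN2 ltr_pdivrMr// mulr_natr mulr2n ltrDl.
by rewrite le_max lexx orbT.
Qed.

Lemma is_derive_affine (a b t : R) : is_derive t 1 (fun s : R => a + b * s) b.
Proof.
have h1 := @is_deriveZ R R R (id : R -> R) b t 1 1 (is_derive_id t 1).
have h2 := @is_deriveD R R R (cst a) (b *: (id : R -> R)) t 1 0 (b *: 1) (is_derive_cst a t 1) h1.
apply: (is_derive_eq h2).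
by rewrite add0r -[b *: 1]/(b * 1) mulr1.
Qed.

Lemma derive_ge0_le (f df : R -> R) (a b : R) : a <= b ->
  (forall t : R, a <= t <= b -> is_derive t 1 f (df t)) ->
  (forall t : R, a <= t <= b -> 0 <= df t) -> f a <= f b.
Proof.
move=> ab fd d0.
have [||c cab fE] := @MVT_segment R f df a b ab.
- by move=> t /[!in_itv]/= /andP[at_ tb]; apply: fd; rewrite !ltW.
- apply: derivable_within_continuous => t /[!in_itv]/= tab.
  by apply: ex_derive; exact: fd.
rewrite -subr_ge0 fE mulr_ge0 ?subr_ge0//; apply: d0.
by move: cab; rewrite in_itv.
Qed.

(** The fundamental theorem of calculus, based at -1 so that the derivatives at
   the end points of [0, 1] are two-sided. *)
Lemma primitive01 (s : R -> R) : continuous s -> exists L : R -> R,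
  [/\ L 0 = 0, forall t : R, 0 <= t <= 1 -> is_derive t 1 L (s t) &
    \int[lebesgue_measure]_(t in `[0, 1]) s t = L 1].
Proof.
move=> sc.
pose G (x : R) := \int[lebesgue_measure]_(t in [set` `[-1, x]]) s t.
have dG (t : R) : 0 <= t <= 1 -> is_derive t 1 G (s t).
  move=> /andP[t0 t1].
  have [|||dGt GE] := @continuous_FTC1_closed R s (-1) t 2 _ _ _ (sc t).
  - by apply: (le_lt_trans t1); rewrite ltr1n.
  - apply: continuous_compact_integrable; first exact: segment_compact.
    exact: continuous_subspaceT.
  - by apply: lt_le_trans t0; rewrite oppr_lt0.
  by rewrite -GE derive1E; apply: derivableP.
exists (fun t : R => G t - G 0); split; first by rewrite subrr.
  move=> t t01; have := dG t t01 => dGt.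
  by apply: is_derive_eq; rewrite subr0.
rewrite /Rintegral (@continuous_FTC2 R s G 0 1)//.
- exact: continuous_subspaceT.
- have cG (t : R) : 0 <= t <= 1 -> {for t, continuous G}.
    by move=> /dG d; apply: differentiable_continuous; apply/derivable1_diffP; exact: ex_derive.
  split.
  + by move=> t /[!in_itv]/= /andP[t0 t1]; have := dG t; rewrite !ltW// => /(_ isT) ?; exact: ex_derive.
  + by apply: cvg_at_right_filter; apply: cG; rewrite lexx ler01.
  + by apply: cvg_at_left_filter; apply: cG; rewrite lexx ler01.
- move=> t /[!in_itv]/= /andP[t0 t1]; apply: is_derive_derive1; apply: dG.
  by rewrite !ltW.
Qed.

End RealLine.

Section Curves.
Context {R : realType} {E : normedModType R} (A : atlas E) (mA : manifold A)
  (fE : fincoord E).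
Implicit Types (c : R -> pt A) (g : bilin_field A).

Lemma dom2_fwd (i j : ix A) p : dom i p -> dom j p ->
  (fwd i @` (dom i `&` dom j)) (fwd i p).
Proof. by move=> di dj; exists p. Qed.

Lemma near_dom c (i : ix A) (t : R) : {for t, continuous c} -> dom i (c t) ->
  \forall s \near t, dom i (c s).
Proof. by move=> cc dc; apply: cc; apply: open_nbhs_nbhs; split=> //; exact: dom_open. Qed.

Lemma chart_continuous c (i : ix A) (t : R) : {for t, continuous c} -> dom i (c t) ->
  {for t, continuous (fwd i \o c)}.
Proof. by move=> cc dc; apply: continuous_comp => //; exact: fwd_continuous. Qed.

Lemma velocity_trans_gen c (i j : ix A) (t : R) : {for t, continuous c} ->
  dom i (c t) -> dom j (c t) -> derivable (fwd i \o c) t 1 ->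
  derivable (fwd j \o c) t 1 /\
  velocity c j t = 'd (trans i j) (fwd i (c t)) (velocity c i t).
Proof.
move=> cc di dj dc.
have [d1 d1E] := derive1_diff_comp dc (trans_differentiable mA (dom2_fwd di dj)).
have nE : \near t, (trans i j \o (fwd i \o c)) t = (fwd j \o c) t.
  near=> s; rewrite /= trans_fwd//; near: s; exact: near_dom.
by have [d2 d2E] := derive1_near_eq nE d1; split=> //; rewrite /velocity d2E.
Unshelve. all: by end_near. Qed.

Lemma velocity_trans c (i j : ix A) (t : R) : C1_curve c -> dom i (c t) -> dom j (c t) ->
  velocity c j t = 'd (trans i j) (fwd i (c t)) (velocity c i t).
Proof. by move=> [_ cc cd] di dj; apply: (velocity_trans_gen (cc t) di dj (cd i t di).1).2. Qed.

(** By the chain rule and the transformation law of g, it does not matter which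
   chart the definition of the speed picks. *)
Lemma speed_chart g c (i : ix A) (t : R) : metric_field g -> C1_curve c -> dom i (c t) ->
  speed g c t = Num.sqrt (g i (fwd i (c t)) (velocity c i t) (velocity c i t)).
Proof.
move=> [_ _ _ gt] Cc di; rewrite /speed.
set P := [set r | _].
have [|j dj ->] := @xgetPex _ 0 P; first by exists (Num.sqrt (g i (fwd i (c t))
  (velocity c i t) (velocity c i t))); exists i.
rewrite (gt i j _ _ _ (dom2_fwd di dj)).
by rewrite trans_fwd// -!velocity_trans.
Qed.

Lemma speed_ge0 g c (t : R) : 0 <= speed g c t.
Proof.
rewrite /speed; case: xgetP => [r _ [i _ ->]|//]; exact: sqrtr_ge0.
Qed.

Lemma speed_continuous g c : metric_field g -> C1_curve c -> continuous (speed g c).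
Proof.
move=> mg Cc t; have [sc cc cd] := Cc; have [i di] := sc t.
pose U := c @^-1` dom i.
have oU : open U by apply: open_comp => [s _|]; [exact: cc|exact: dom_open].
have H : Ck 0 U (fun s => g i (fwd i (c s)) (velocity c i s) (velocity c i s)).
  apply: (Ck_metric mA fE mg oU).
  - by move=> s ds; exists (c s).
  - by move=> s ds; exact: (chart_continuous (cc s) ds).
  - by move=> s ds; exact: (cd i s ds).2.
  - by move=> s ds; exact: (cd i s ds).2.
have H2 : {for t, continuous (Num.sqrt \o
    (fun s => g i (fwd i (c s)) (velocity c i s) (velocity c i s)))}.
  by apply: continuous_comp; [exact: H|exact: sqrt_continuous].
suff : Ck 0 U (speed g c) by move=> /(_ t); apply.
apply: (Ck_eq (f := Num.sqrt \o
    (fun s => g i (fwd i (c s)) (velocity c i s) (velocity c i s)))) => //.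
  by move=> s ds; rewrite (speed_chart mg Cc ds).
by move=> s ds; apply: continuous_comp; [exact: H|exact: sqrt_continuous].
Qed.

Lemma arclength g c : metric_field g -> C1_curve c -> exists L : R -> R,
  [/\ L 0 = 0, forall t : R, 0 <= t <= 1 -> is_derive t 1 L (speed g c t) &
    \int[lebesgue_measure]_(t in `[0, 1]) speed g c t = L 1].
Proof. by move=> mg Cc; apply: primitive01; exact: speed_continuous. Qed.

(** Lengths are compared through antiderivatives; with a composition for T this
   also serves as the substitution rule for reparametrised curves. *)
Lemma length_le g c (T dT : R -> R) : metric_field g -> C1_curve c ->
  (forall t : R, 0 <= t <= 1 -> is_derive t 1 T (dT t)) ->
  (forall t : R, 0 <= t <= 1 -> speed g c t <= dT t) ->
  \int[lebesgue_measure]_(t in `[0, 1]) speed g c t <= T 1 - T 0.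
Proof.
move=> mg Cc Td Tl; have [L [L0 dL ->]] := arclength mg Cc.
have : T 0 - L 0 <= T 1 - L 1.
  apply: (@derive_ge0_le _ (fun t => T t - L t) (fun t => dT t - speed g c t)) => //.
    by move=> t t01; have := Td t t01; have := dL t t01 => ? ?; exact: is_deriveB.
  by move=> t t01; rewrite subr_ge0; exact: Tl.
by rewrite L0 => ?; lra.
Qed.

Lemma length_ge g c (T dT : R -> R) : metric_field g -> C1_curve c ->
  (forall t : R, 0 <= t <= 1 -> is_derive t 1 T (dT t)) ->
  (forall t : R, 0 <= t <= 1 -> dT t <= speed g c t) ->
  T 1 - T 0 <= \int[lebesgue_measure]_(t in `[0, 1]) speed g c t.
Proof.
move=> mg Cc Td Tl; have [L [L0 dL ->]] := arclength mg Cc.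
have : L 0 - T 0 <= L 1 - T 1.
  apply: (@derive_ge0_le _ (fun t => L t - T t) (fun t => speed g c t - dT t)) => //.
    by move=> t t01; have := Td t t01; have := dL t t01 => ? ?; exact: is_deriveB.
  by move=> t t01; rewrite subr_ge0; exact: Tl.
by rewrite L0 => ?; lra.
Qed.

Lemma joined_ge0 g p q l : metric_field g -> joined g p q l -> 0 <= l.
Proof.
move=> mg; elim=> {p q l} [c Cc|p q r l1 l2 _ h1 _ h2]; last exact: addr_ge0.
have := @length_ge g c (fun=> 0 : R) (fun=> 0 : R) mg Cc; rewrite subrr; apply.
by move=> t _; exact: speed_ge0.
Qed.

Lemma reparam c (f df : R -> R) : C1_curve c ->
  (forall t : R, is_derive t 1 f (df t)) -> continuous df ->
  C1_curve (c \o f) /\ forall (i : ix A) t, dom i (c (f t)) ->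
    velocity (c \o f) i t = df t *: velocity c i (f t).
Proof.
move=> [sc cc cd] fd dfc.
have dif t : derivable f t 1 by apply: ex_derive; exact: fd.
have fc : continuous f.
  by move=> t; apply: differentiable_continuous; apply/derivable1_diffP; exact: dif.
have vE (i : ix A) t : dom i (c (f t)) ->
    derivable (fwd i \o (c \o f)) t 1 /\ velocity (c \o f) i t = df t *: velocity c i (f t).
  move=> di; have [dc _] := cd i (f t) di.
  have [|d1 d1E] := derive1_diff_comp (f := f) (h := fwd i \o c) (dif t).
    exact/derivable1_diffP.
  split=> //; rewrite /velocity d1E (is_derive_derive1 (fd t)) diff1E//.
  exact/derivable1_diffP.
split; last by move=> i t /vE[].
split; first by move=> t; exact: sc.
  by move=> t; apply: continuous_comp; [exact: fc|exact: cc].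
move=> i t di; split; first by have [] := vE i t di.
pose U := (c \o f) @^-1` dom i.
have oU : open U.
  apply: open_comp => [s _|]; last exact: dom_open.
  by apply: continuous_comp; [exact: fc|exact: cc].
suff : Ck 0 U (velocity (c \o f) i) by move=> /(_ t); apply.
apply: (Ck_eq (f := fun s => df s *: velocity c i (f s))) => //.
  by move=> s ds; rewrite (vE i s ds).2.
move=> s ds; apply: continuousZ; first exact: dfc.
by apply: (@continuous_comp _ _ _ f); [exact: fc|exact: (cd i (f s) ds).2].
Qed.

Lemma speed_reparam g c (f df : R -> R) t : metric_field g -> C1_curve c ->
  (forall t : R, is_derive t 1 f (df t)) -> continuous df ->
  speed g (c \o f) t = `|df t| * speed g c (f t).
Proof.
move=> mg Cc fd dfc; have [Ccf vE] := reparam Cc fd dfc.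
have [i di] : exists i, dom i (c (f t)) by case: Cc => sc _ _; exact: sc.
rewrite (speed_chart mg Ccf di) (speed_chart mg Cc di) vE//.
have [gl gs _ _] := mg; have ii : img i (fwd i (c (f t))) by exists (c (f t)).
rewrite (bformZl (fun u => gl i _ u ii) (fun u v => gs i _ u v ii)).
rewrite (bformZr (fun u => gl i _ u ii)) mulrA -expr2 sqrtrM ?sqr_ge0//.
by rewrite sqrtr_sqr.
Qed.

End Curves.

(** * The Riemannian distance induces the topology *)

Section Distance.
Context {R : realType} {E : normedModType R} (A : atlas E) (mA : manifold A)
  (fE : fincoord E).
Implicit Types (c : R -> pt A) (g : bilin_field A).

Lemma riem_distP g p q (e : R) :
  (riem_dist g p q < e%:E)%E <-> exists2 l, l < e & joined g p q l.
Proof.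
split=> [/ereal_inf_lt[_ [l jl <-]]|[l le jl]].
  by rewrite lte_fin => le; exists l.
apply: (@le_lt_trans _ _ l%:E); last by rewrite lte_fin.
by apply: ereal_inf_lbound; exists l.
Qed.

Lemma joined_sym g p q l : metric_field g -> joined g p q l ->
  exists2 l', l' <= l & joined g q p l'.
Proof.
move=> mg; elim=> {p q l} [c Cc|p q r l1 l2 _ [l1' h1 j1] _ [l2' h2 j2]]; last first.
  by exists (l2' + l1'); [rewrite addrC lerD|exact: joined_cat j2 j1].
pose f : R -> R := fun t => 1 + -1 * t.
have fd (t : R) : is_derive t 1 f (-1) by exact: is_derive_affine.
have dfc : continuous (fun _ : R => -1 : R) by move=> t; exact: cst_continuous.
have [Ccf vE] := reparam mA Cc fd dfc.
have [L [L0 dL LE]] := arclength mA fE mg Cc.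
exists (\int[lebesgue_measure]_(t in `[0, 1]) speed g (c \o f) t); last first.
  by have := joined_C1 g Ccf; rewrite /= /f mulr0 addr0 mulr1 subrr.
rewrite LE.
have -> : L 1 = (fun t => - L (f t)) 1 - (fun t => - L (f t)) 0.
  by rewrite /f mulr0 addr0 mulr1 subrr L0 oppr0 sub0r opprK.
apply: (@length_le _ _ _ mA fE g (c \o f) (fun t => - L (f t)) (fun t => speed g c (f t)) mg Ccf).
  move=> t /andP[t0 t1].
  have : is_derive (f t) 1 L (speed g c (f t)) by apply: dL; rewrite /f; apply/andP; split; lra.
  move=> dLf; have := @is_derive1_comp R L f t _ _ dLf (fd t).
  rewrite mulrN1 => h.
  by have := is_deriveN h; rewrite opprK.
by move=> t _; rewrite (speed_reparam mA t mg Cc fd dfc) normrN normr1 mul1r.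
Qed.

Lemma derive_near (V : normedModType R) (f : R -> V) (t e : R) (v : V) :
  is_derive t 1 f v -> 0 < e ->
  exists2 d : R, 0 < d & forall h, 0 < h < d -> `|f (t + h) - f t - h *: v| <= e * h.
Proof.
move=> fd e0.
have : (fun h : R => h^-1 *: ((f \o shift t) (h *: 1) - f t)) @ 0^' --> v.
  by have [h <-] := fd; exact: h.
move=> /cvgrPdist_le /(_ e e0) [d /= d0 dP].
exists d => // h /andP[h0 hd].
have := dP h; rewrite /= sub0r normrN gtr0_norm// => /(_ hd).
rewrite gt_eqF// => /(_ isT); rewrite -(ler_pM2l h0) -{1}(gtr0_norm h0) -normrZ.
rewrite scalerBr scalerA mulfV ?gt_eqF// scale1r -[h *: 1]/(h * 1) mulr1 (addrC h).
by rewrite distrC mulrC.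
Qed.

(** While the curve is in the ball, its coordinate velocity is at most k times
   its speed, so that real induction bounds the coordinate distance by k times
   the length; a limit of points of the compact ball is still in the chart. *)
Lemma curve_in_chart g c (i : ix A) (x0 : E) (r k rho : R) :
  metric_field g -> C1_curve c -> 0 < k ->
  (forall y, `|y - x0| <= r ->
    img i y /\ forall v, `|v| <= k * Num.sqrt (g i y v v)) ->
  dom i (c 0) -> `|fwd i (c 0) - x0| <= rho ->
  let l := \int[lebesgue_measure]_(t in `[0, 1]) speed g c t in
  rho + k * l < r ->
  dom i (c 1) /\ `|fwd i (c 1) - x0| <= rho + k * l.
Proof.
move=> mg Cc k0 ball d0 x0rho l; rewrite /l.
have [L [L0 dL ->]] := arclength mA fE mg Cc => {l} lr.
have [sc cc cd] := Cc.
pose x t := fwd i (c t).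
have L1 (t : R) : 0 <= t <= 1 -> L t <= L 1.
  move=> /andP[t0 t1]; apply: (@derive_ge0_le _ L (speed g c)) => //.
    by move=> s /andP[ts s1]; apply: dL; rewrite s1 (le_trans t0).
  by move=> s _; exact: speed_ge0.
have Lc (t : R) : 0 <= t <= 1 -> {for t, continuous L}.
  move=> /dL d; apply: differentiable_continuous; apply/derivable1_diffP; exact: ex_derive.
(* The term e * t absorbs the errors of the first-order expansions of x and L. *)
suff main e : 0 < e -> e < r - (rho + k * L 1) -> forall t, 0 <= t <= 1 ->
    dom i (c t) /\ `|x t - x0| <= rho + k * L t + e * t.
  set e0 := (r - (rho + k * L 1)) / 2.
  have e00 : 0 < e0 by rewrite divr_gt0// subr_gt0.
  have e0r : e0 < r - (rho + k * L 1).
    by rewrite ltr_pdivrMr// mulr_natr mulr2n ltrDl subr_gt0.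
  have one : 0 <= (1 : R) <= 1 by rewrite ler01 lexx.
  split; first by have [] := main e0 e00 e0r 1 one.
  apply/ler_addgt0Pr => e eps0.
  have e10 : 0 < Num.min e e0 by rewrite lt_min eps0.
  have e1r : Num.min e e0 < r - (rho + k * L 1) by rewrite gt_min e0r orbT.
  have [_] := main (Num.min e e0) e10 e1r 1 one.
  by rewrite mulr1 => /le_trans; apply; rewrite lerD2l ge_min lexx.
move=> e0 er.
have inball (t : R) : 0 <= t <= 1 -> `|x t - x0| <= rho + k * L t + e * t -> `|x t - x0| <= r.
  move=> t01 /le_trans; apply; have := L1 t t01; rewrite -(ler_pM2l k0) => kL.
  move: t01 => /andP[t0 t1]; have : e * t <= e by rewrite ger_pMr.
  lra.
apply: real_induction.
- by rewrite L0 !mulr0 !addr0.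
- move=> t /andP[t0 t1] Ps.
  have [|di xt] := Ps t; first by rewrite t0 lexx.
  have t01 : 0 <= t <= 1 by rewrite t0 ltW.
  have [_ vk] := ball (x t) (inball t t01 xt).
  have [dx _] := cd i t di.
  have ddx : is_derive t 1 x (velocity c i t).
    by rewrite /velocity derive1E; exact: derivableP.
  have e2 : 0 < e / 2 by rewrite divr_gt0.
  have ek : 0 < e / 2 / k by rewrite divr_gt0.
  have [d1 d10 h1] := derive_near ddx e2.
  have [d2 d20 h2] := derive_near (dL t t01) ek.
  have [d3 /= d30 h3] := near_dom mA (cc t) di.
  exists (Num.min d1 (Num.min d2 d3)); first by rewrite !lt_min d10 d20 d30.
  move=> s /andP[ts]; rewrite -ltrBlDl !lt_min => /and3P[s1 s2 s3].
  have h0 : 0 < s - t by rewrite subr_gt0.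
  have sE : s = t + (s - t) by rewrite addrC subrK.
  split.
    by apply: h3; rewrite /= distrC gtr0_norm.
  have := h1 (s - t); rewrite h0 s1 -sE => /(_ isT) k1.
  have := h2 (s - t); rewrite h0 s2 -sE => /(_ isT) k2.
  have vs : `|velocity c i t| <= k * speed g c t.
    by rewrite (speed_chart mA mg Cc di); exact: vk.
  have n1 : `|x s - x0| <= `|x t - x0| + `|(s - t) *: velocity c i t| + e / 2 * (s - t).
    have -> : x s - x0 = (x t - x0) + (s - t) *: velocity c i t
       + (x s - x t - (s - t) *: velocity c i t).
      by rewrite -addrA (addrC (_ *: _)) subrK [RHS]addrC addrA subrK.
    apply: (le_trans (ler_normD _ _)); apply: lerD => //; exact: ler_normD.
  rewrite normrZ (gtr0_norm h0) in n1.
  have n2 : (s - t) * `|velocity c i t| <= (s - t) * (k * speed g c t) by rewrite ler_pM2l.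
  have n3 : (s - t) * speed g c t <= L s - L t + e / 2 / k * (s - t).
    move: k2; rewrite -[_ *: _]/(_ * _) distrC ler_norml => /andP[_]; lra.
  move: n3; rewrite -(ler_pM2l k0) mulrDr.
  have -> : k * (e / 2 / k * (s - t)) = e / 2 * (s - t).
    by field; rewrite gt_eqF.
  move=> n3; lra.
- move=> t /andP[t0 t1] Ps.
  have t01 : 0 <= t <= 1 by rewrite t1 ltW.
  pose K := [set y | `|y - x0| <= r].
  have cK : compact K.
    apply: (@fincoord_compact _ _ _ (r + `|x0|) fE).
      have -> : K = (fun y => `|y - x0|) @^-1` [set z | z <= r] by [].
      apply: closed_comp; last exact: closed_le.
      move=> y _; apply: (@continuous_comp _ _ _ (fun y => y - x0)).
        by apply: continuousB; [exact: cvg_id|exact: cst_continuous].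
      exact: norm_continuous.
    move=> y /= Ky; rewrite -[y](subrK x0); apply: (le_trans (ler_normD _ _)).
    by rewrite lerD2r.
  have cKp : closed (bwd (a := A) i @` K).
    apply: compact_closed; first exact: mfd_hausdorff.
    apply: continuous_compact => //; apply: continuous_in_subspaceT => y /[!inE] Ky.
    by apply: bwd_continuous => //; exact: (ball y Ky).1.
  have st1 (s : R) : 0 <= s < t -> 0 <= s <= 1.
    by move=> /andP[s0 st]; rewrite s0 (le_trans (ltW st)).
  have [|y Ky yct] := closed_left (cc t) cKp t0.
    move=> s sst; have [di xs] := Ps s sst; exists (x s); last by rewrite /x fwdK.
    exact: inball (st1 s sst) xs.
  have di : dom i (c t) by rewrite -yct; apply: img_bwd => //; exact: (ball y Ky).1.
  split=> //.
  pose f s := `|x s - x0| - (rho + k * L s + e * s).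
  have fc : {for t, continuous f}.
    apply: continuousB.
      apply: (@continuous_comp _ _ _ (fun s => x s - x0)); last exact: norm_continuous.
      apply: continuousB; [|exact: cst_continuous].
      exact: (chart_continuous mA (cc t) di).
    apply: continuousD; last by apply: continuousM; [exact: cst_continuous|exact: cvg_id].
    apply: continuousD; first exact: cst_continuous.
    by apply: continuousM; [exact: cst_continuous|exact: Lc].
  rewrite -subr_le0; apply: (@closed_left _ _ f [set z : R | z <= 0] t fc (@closed_le _ 0) t0) => s sst /=.
  by rewrite subr_le0; exact: (Ps s sst).2.
Qed.

Lemma chart_bounds g (i : ix A) (x0 : E) : riemannian g -> img i x0 ->
  exists r k K : R, [/\ 0 < r, 0 < k, 0 < K &
    forall y, `|y - x0| <= r -> img i y /\ forall v,
      `|v| <= k * Num.sqrt (g i y v v) /\ Num.sqrt (g i y v v) <= K * `|v|].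
Proof.
move=> [[gl gs gsm _] gpos] ix0.
have ni : \near x0, img i x0 by apply: open_nbhs_nbhs; split=> //; exact: img_open.
have [|||m [M [m0 M0 near_b]]] := @bform_near_bounds R E E x0 (g i) fE.
- near=> y; have iy : img i y by near: y.
  by split=> *; [exact: gl|exact: gs].
- by move=> u; exact: gpos.
- by move=> u v; exact: (gsm i u v 0).
have [r /= r0 rP] := proj1 (nbhs_normP _ _) (filterI ni near_b).
exists (r / 2), m^-1, M; split; rewrite ?divr_gt0 ?invr_gt0//.
move=> y yr; have [|iy gb] := rP y.
  by rewrite /= distrC (le_lt_trans yr)// ltr_pdivrMr// mulr_natr mulr2n ltrDl.
split=> // v; have [b1 b2] := gb v; split.
  rewrite -(ler_pM2l m0) mulrA mulfV ?gt_eqF// mul1r.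
  have -> : m * `|v| = Num.sqrt (m ^+ 2 * `|v| ^+ 2).
    by rewrite -exprMn sqrtr_sqr ger0_norm// mulr_ge0// ltW.
  exact: ler_wsqrtr.
have -> : M * `|v| = Num.sqrt (M ^+ 2 * `|v| ^+ 2).
  by rewrite -exprMn sqrtr_sqr ger0_norm// mulr_ge0// ltW.
exact: ler_wsqrtr.
Unshelve. all: by end_near. Qed.

(** Leaving a coordinate ball around p takes a definite length, since in the
   chart g is bounded below by a multiple of the square of the norm. *)
Lemma joined_short_nbhs g p (U : set (pt A)) : riemannian g -> supp p -> nbhs p U ->
  exists2 e : R, 0 < e & forall q l, joined g p q l -> l < e -> U q.
Proof.
move=> rg [i di] pU; have [mg _] := rg.
have ip : img i (fwd i p) by exists p.
have [r [k [K [r0 k0 K0 bd]]]] := chart_bounds rg ip.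
have : nbhs (fwd i p) (bwd i @^-1` U).
  by apply: (bwd_continuous mA ip); rewrite fwdK.
move=> /(proj1 (nbhs_normP _ _))[s /= s0 sU].
pose r' := Num.min r s.
have r'0 : 0 < r' by rewrite lt_min r0.
exists (r' / k); first by rewrite divr_gt0.
have gen p' q l : joined g p' q l -> forall rho, dom i p' -> `|fwd i p' - fwd i p| <= rho ->
    rho + k * l < r' -> dom i q /\ `|fwd i q - fwd i p| <= rho + k * l.
  elim=> {p' q l} [c Cc|p1 p2 p3 l1 l2 j1 h1 j2 h2] rho dp hp hr.
    apply: (@curve_in_chart g c i (fwd i p) r' k rho) => // y yr.
    have [|iy vb] := bd y; first by rewrite (le_trans yr)// ge_min lexx.
    by split=> // v; have [] := vb v.
  have l20 : 0 <= k * l2 by apply: mulr_ge0; [exact: ltW|exact: (joined_ge0 mA fE mg j2)].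
  have [|d2 b2] := h1 rho dp hp; first by move: hr; rewrite mulrDr; lra.
  rewrite mulrDr addrA in hr *; exact: h2.
move=> q l jl le.
have hl : 0 + k * l < r' by rewrite add0r mulrC -ltr_pdivlMr.
have [|dq qb] := gen p q l jl 0 di _ hl; first by rewrite subrr normr0.
rewrite -(fwdK mA dq); apply: sU; rewrite /= distrC.
by apply: (le_lt_trans qb); apply: (lt_le_trans hl); rewrite ge_min lexx orbT.
Qed.

Lemma C1_curve_chart c (i : ix A) : continuous c -> (forall t, dom i (c t)) ->
  (forall t, derivable (fwd i \o c) t 1) -> continuous (velocity c i) -> C1_curve c.
Proof.
move=> cc di dc vc; split=> [t|//|j t dj]; first by exists i.
split; first by have [] := velocity_trans_gen mA (cc t) (di t) dj (dc t).
pose U := c @^-1` dom j.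
have oU : open U by apply: open_comp => [s _|]; [exact: cc|exact: dom_open].
suff : Ck 0 U (velocity c j) by move=> /(_ t); apply.
apply: (Ck_eq (f := fun s => 'd (trans i j) (fwd i (c s)) (velocity c i s))) => //.
  by move=> s ds; have [_ ->] := velocity_trans_gen mA (cc s) (di s) ds (dc s).
have /CkSP[_ C0] := trans_smooth mA i j 1.
have oD := open_dom2 mA i j.
have C1 : @Ck R 0 R (E * E)%type U (fun s => (fwd i (c s), velocity c i s)).
  apply: Ck_pair => // s ds; last exact: vc.
  exact: (chart_continuous mA (cc s)).
apply: (Ck_comp oU (openXT oD) _ C1 C0).
by move=> s ds; split=> //=; apply: dom2_fwd.
Qed.

(** Curves are parametrised by the whole line. This pace is smooth, runs from 0
   to 1 on [0, 1] and keeps all values in [0, 1], so that a segment followed at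
   this pace never leaves a convex set. *)
Definition ease (t : R) : R := 2^-1 * (1 - cos (pi * t)).

Lemma ease_derive (t : R) : is_derive t 1 ease (2^-1 * (pi * sin (pi * t))).
Proof.
have d1 : is_derive t 1 (fun s : R => 0 + pi * s) pi by exact: is_derive_affine.
have d2 := @is_derive1_comp R cos (fun s : R => 0 + pi * s) t _ _ (is_derive_cos _) d1.
have d3 := @is_derive1_comp R (fun s => 2^-1 + (- 2^-1) * s) _ t _ _
  (is_derive_affine _ _ _) d2.
have -> : ease = (fun s => 2^-1 + (- 2^-1) * s) \o (cos \o (fun s : R => 0 + pi * s)).
  by apply/funext => s; rewrite /ease /= add0r; ring.
by apply: (is_derive_eq d3); rewrite add0r; ring.
Qed.

Lemma ease_itv t : 0 <= ease t <= 1.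
Proof. by rewrite /ease; have := cos_geN1 (pi * t); have := cos_le1 (pi * t); lra. Qed.

Lemma segment_joined g (i : ix A) (x0 : E) (r K : R) x y : metric_field g -> 0 < K ->
  (forall y, `|y - x0| <= r ->
    img i y /\ forall v, Num.sqrt (g i y v v) <= K * `|v|) ->
  `|x - x0| <= r -> `|y - x0| <= r ->
  exists2 l, l <= K * pi * `|y - x| & joined g (bwd i x) (bwd i y) l.
Proof.
move=> mg K0 ball xr yr.
pose z t := x + ease t *: (y - x).
have zr t : `|z t - x0| <= r.
  have /andP[e0 e1] := ease_itv t.
  have -> : z t - x0 = (1 - ease t) *: (x - x0) + ease t *: (y - x0).
    rewrite /z scalerBl scale1r addrAC -[RHS]addrA; congr (_ + _).
    rewrite [RHS]addrC -scalerBr; congr (_ *: _).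
    by rewrite opprB addrA subrK.
  apply: (le_trans (ler_normD _ _)); rewrite !normrZ !ger0_norm ?subr_ge0//.
  have -> : r = (1 - ease t) * r + ease t * r by ring.
  by apply: lerD; apply: ler_wpM2l; rewrite ?subr_ge0.
have iz t : img i (z t) by have [] := ball _ (zr t).
pose c t := bwd (a := A) i (z t).
pose w t := (2^-1 * (pi * sin (pi * t))) *: (y - x).
have dz (t : R) : is_derive t 1 z (w t).
  have de := ease_derive t.
  have dd : differentiable ease t by apply/derivable1_diffP; exact: ex_derive.
  have d1 : differentiable z t.
    by apply: differentiableD => //; apply: differentiableZl.
  have -> : w t = derive1 z t.
    rewrite derive1E' //.
    have -> : z = (cst x : R -> E) + (fun s => ease s *: (y - x)) by [].
    rewrite diffD//; last exact: differentiableZl.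
    rewrite diffZl// diff_cst /= [RHS]add0r /w; congr (_ *: _).
    by rewrite -derive1E' // (is_derive_derive1 de).
  by rewrite derive1E; apply: derivableP; exact/derivable1_diffP.
have zc : continuous z.
  by move=> t; apply: differentiable_continuous; apply/derivable1_diffP; exact: ex_derive.
have fz : fwd i \o c = z by apply/funext => t; rewrite /c /= bwdK.
have vE : velocity c i = w.
  by apply/funext => t; rewrite /velocity fz; exact: is_derive_derive1.
have Cc : C1_curve c.
  apply: (@C1_curve_chart _ i).
  - move=> t; apply: (@continuous_comp _ _ _ z (bwd i)); first exact: zc.
    by apply: bwd_continuous => //; exact: iz.
  - by move=> t; apply: img_bwd.
  - by move=> t; rewrite fz; exact: ex_derive.
  - rewrite vE => t; suff /(_ t) : Ck 0 setT w by apply.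
    apply: Ck_scalec; first exact: openT.
    apply: Ck_mul; [exact: openT|exact: Ck_cst|].
    apply: Ck_mul; [exact: openT|exact: Ck_cst|] => s _.
    apply: (@continuous_comp _ _ _ ( *%R pi) sin); last exact: continuous_sin.
    by apply: continuousM; [exact: cst_continuous|exact: cvg_id].
have len : \int[lebesgue_measure]_(t in `[0, 1]) speed g c t <= K * pi * `|y - x|.
  pose T (t : R) := 0 + (K * pi * `|y - x|) * t.
  have -> : K * pi * `|y - x| = T 1 - T 0 by rewrite /T mulr1 mulr0 addr0 subr0 add0r.
  apply: (@length_le _ _ _ mA fE g c T (fun=> K * pi * `|y - x|) mg Cc).
    by move=> t _; exact: is_derive_affine.
  move=> t _; have dt : dom i (c t) by apply: img_bwd.
  rewrite (speed_chart mA mg Cc dt) vE /c bwdK//.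
  have [_ /(_ (w t))] := ball _ (zr t); move=> /le_trans; apply.
  rewrite -mulrA ler_pM2l// /w normrZ; apply: ler_wpM2r => //.
  rewrite normrM normrM (gtr0_norm (pi_gt0 R)) ger0_norm//.
  have := sin_max (pi * t).
  have := pi_gt0 R; set s := `|sin _|; have : 0 <= s by exact: normr_ge0.
  nra.
exists (\int[lebesgue_measure]_(t in `[0, 1]) speed g c t) => //.
have := joined_C1 g Cc; rewrite /c /z /ease mulr0 cos0 subrr mulr0 scale0r addr0.
rewrite mulr1 cospi opprK.
have -> : 2^-1 * (1 + 1) = 1 :> R by field.
by rewrite scale1r [x + _]addrC subrK.
Qed.

(** In the chart, a segment towards p has length at most a constant times its
   coordinate length. *)
Lemma near_joined_short g p (e : R) : riemannian g -> supp p -> 0 < e ->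
  \forall q \near p, exists2 l, l < e & joined g q p l.
Proof.
move=> rg [i di] e0; have [mg _] := rg.
have ip : img i (fwd i p) by exists p.
have [r [k [K [r0 k0 K0 bd]]]] := chart_bounds rg ip.
have Kp : 0 < K * pi by rewrite mulr_gt0// pi_gt0.
have d0 : 0 < Num.min r (e / (K * pi)) by rewrite lt_min r0 divr_gt0.
have ndi : \near p, dom i p by apply: open_nbhs_nbhs; split=> //; exact: dom_open.
have nfi : \forall q \near p, `|fwd i p - fwd i q| < Num.min r (e / (K * pi)).
  by have /cvgrPdist_lt /(_ _ d0) := fwd_continuous mA di.
near=> q.
have dq : dom i q by near: q.
have : `|fwd i p - fwd i q| < Num.min r (e / (K * pi)) by near: q.
rewrite lt_min => /andP[h1 h2].
have [|||l ll jl] := @segment_joined g i (fwd i p) r K (fwd i q) (fwd i p) mg K0 _ _ _.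
- by move=> y yr; have [iy vb] := bd y yr; split=> // v; have [] := vb v.
- by rewrite distrC ltW.
- by rewrite subrr normr0 ltW.
exists l; last by rewrite !fwdK in jl.
by apply: (le_lt_trans ll); rewrite mulrC -ltr_pdivlMr.
Unshelve. all: by end_near. Qed.

End Distance.

(** * Completeness *)

Section Completeness.
Context {R : realType} {E : normedModType R} (A : atlas E) (mA : manifold A)
  (fE : fincoord E).
Implicit Types (c : R -> pt A) (g : bilin_field A).

Lemma riem_cvgP g p (u : nat -> pt A) : riemannian g -> supp p ->
  (forall e : R, 0 < e -> exists N : nat, forall k : nat,
      (N <= k)%N -> (riem_dist g (u k) p < e%:E)%E) <-> u @ \oo --> p.
Proof.
move=> rg sp; have [mg _] := rg; split=> [h U pU|h e e0].
  have [e e0 eU] := joined_short_nbhs mA fE rg sp pU.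
  have [N NP] := h e e0; exists N => // k /= /NP /riem_distP[l le jl].
  have [l' ll jl'] := joined_sym mA fE mg jl.
  by apply: eU jl' _; exact: le_lt_trans le.
have [N _ NP] := h _ (near_joined_short mA fE rg sp e0).
by exists N => k /NP /= ?; exact/riem_distP.
Qed.

Lemma joined_compare g h (k : R) p q l : metric_field g -> metric_field h -> 0 < k ->
  (forall (i : ix A) x v, img i x -> k ^+ 2 * g i x v v <= h i x v v) ->
  joined h p q l -> exists2 l', k * l' <= l & joined g p q l'.
Proof.
move=> mg mh k0 gh; elim=> {p q l} [c Cc|p q r l1 l2 _ [l1' h1 j1] _ [l2' h2 j2]].
  exists (\int[lebesgue_measure]_(t in `[0, 1]) speed g c t); last exact: joined_C1.
  have [L [L0 dL ->]] := arclength mA fE mh Cc.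
  rewrite mulrC -ler_pdivlMr//.
  have -> : L 1 / k = (fun t => k^-1 * L t) 1 - (fun t => k^-1 * L t) 0.
    by rewrite L0 mulr0 subr0 mulrC.
  apply: (@length_le _ _ _ mA fE g c (fun t => k^-1 * L t) (fun t => k^-1 * speed h c t) mg Cc).
    by move=> t /dL d; exact: (@is_deriveZ R R R L k^-1 t 1 _ d).
  move=> t _; have [i di] : supp (c t) by case: Cc.
  rewrite (speed_chart mA mg Cc di) (speed_chart mA mh Cc di).
  have ii : img i (fwd i (c t)) by exists (c t).
  rewrite -(ler_pM2l k0) mulrA mulfV ?gt_eqF// mul1r.
  have {1}-> : k = Num.sqrt (k ^+ 2) by rewrite sqrtr_sqr ger0_norm// ltW.
  by rewrite -sqrtrM ?sqr_ge0//; apply: ler_wsqrtr; exact: gh.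
by exists (l1' + l2'); [rewrite mulrDr lerD|exact: joined_cat j1 j2].
Qed.

(** Cauchy sequences for h are Cauchy for g, and a limit for g is one for h as
   both distances induce the topology of the manifold. *)
Lemma complete_compare g h (k : R) : riemannian g -> riemannian h -> 0 < k ->
  (forall (i : ix A) x v, img i x -> k ^+ 2 * g i x v v <= h i x v v) ->
  complete_metric g -> complete_metric h.
Proof.
move=> rg rh k0 gh cg u su uC; have [[mg _] [mh _]] := (rg, rh).
have [|p sp up] := cg u su.
  move=> e e0; have [|N NP] := uC (k * e); first exact: mulr_gt0.
  exists N => a b aN bN; have /riem_distP[l le jl] := NP a b aN bN.
  have [l' ll jl'] := joined_compare mg mh k0 gh jl.
  by apply/riem_distP; exists l' => //; rewrite -(ltr_pM2l k0); exact: le_lt_trans le.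
by exists p => //; apply/riem_cvgP => //; exact/(riem_cvgP _ rg sp).
Qed.

(** The length of x over [a, b] is at most S b - S a, and S is monotone and
   bounded; hence x 0, x 1, x 2, ... is a Cauchy sequence, and x stays close to
   it. *)
Lemma curve_cvg g (x : R -> pt A) (S dS : R -> R) (M : R) :
  riemannian g -> complete_metric g -> C1_curve x ->
  (forall t : R, is_derive t 1 S (dS t)) ->
  (forall t, 0 <= t -> speed g x t <= dS t) ->
  (forall t, 0 <= t -> S t <= M) ->
  exists2 p, supp p & x @ +oo --> p.
Proof.
move=> rg cg Cx dSd sS SM; have [mg _] := rg.
have jx a b : 0 <= a -> a <= b ->
    exists2 l, l <= S b - S a & joined g (x a) (x b) l.
  move=> a0 ab.
  pose f (t : R) := a + (b - a) * t.
  have fd (t : R) : is_derive t 1 f (b - a) by exact: is_derive_affine.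
  have dfc : continuous (fun _ : R => b - a : R) by move=> t; exact: cst_continuous.
  have [Cxf _] := reparam mA Cx fd dfc.
  have f0 : f 0 = a by rewrite /f mulr0 addr0.
  have f1 : f 1 = b by rewrite /f mulr1 addrC subrK.
  exists (\int[lebesgue_measure]_(t in `[0, 1]) speed g (x \o f) t); last first.
    by have := joined_C1 g Cxf; rewrite /= f0 f1.
  have -> : S b - S a = (S \o f) 1 - (S \o f) 0 by rewrite /= f0 f1.
  apply: (@length_le _ _ _ mA fE g (x \o f) (S \o f) (fun t => (b - a) * dS (f t)) mg Cxf).
    move=> t _; have := @is_derive1_comp R S f t _ _ (dSd (f t)) (fd t).
    by rewrite mulrC.
  move=> t /andP[t0 t1]; rewrite (speed_reparam mA t mg Cx fd dfc).
  rewrite ger0_norm ?subr_ge0//; apply: ler_wpM2l; first by rewrite subr_ge0.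
  by apply: sS; rewrite /f addr_ge0// mulr_ge0// subr_ge0.
pose B := [set S t | t in [set t : R | 0 <= t]].
have hB : has_sup B.
  by split; [exists (S 0), 0 => //=|exists M => _ [t t0 <-]; exact: SM].
have Ss t : 0 <= t -> S t <= sup B.
  by move=> t0; apply: ub_le_sup; [exact: hB.2|exists t].
have close e : 0 < e -> exists2 a, 0 <= a & forall s t, a <= s -> a <= t ->
    exists2 l, l < e & joined g (x s) (x t) l.
  move=> e0; have [_ [a a0 <-] aP] := sup_adherent e0 hB; exists a => // s t sa ta.
  have inc s' t' : a <= s' -> s' <= t' -> exists2 l, l < e & joined g (x s') (x t') l.
    move=> sa' st'; have s0 := le_trans a0 sa'.
    have [l ll jl] := jx s' t' s0 st'; exists l => //.
    have := Ss t' (le_trans s0 st').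
    have : S a <= S s'.
      apply: (@derive_ge0_le _ S dS a s' sa') => r /andP[ar _].
      by apply: le_trans (sS _ (le_trans a0 ar)); exact: speed_ge0.
    lra.
  have [st|/ltW ts] := leP s t; first exact: inc.
  have [l le jl] := inc t s ta ts.
  have [l' ll jl'] := joined_sym mA fE mg jl.
  by exists l' => //; exact: le_lt_trans le.
have natN (a : R) : 0 <= a -> exists N : nat, forall k, (N <= k)%N -> a <= k%:R.
  move=> a0; exists (Num.Def.archi_bound a) => k kN.
  apply: (le_trans (ltW (archi_boundP a0))); by rewrite ler_nat.
have sx t : supp (x t) by case: Cx.
have [|p sp up] := cg (fun k => x k%:R) (fun k => sx _).
  move=> e e0; have [a a0 aP] := close e e0; have [N NP] := natN a a0.
  by exists N => k l kN lN; apply/riem_distP; apply: aP; exact: NP.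
exists p => // U pU.
have [e e0 eU] := joined_short_nbhs mA fE rg sp pU.
have e2 : 0 < e / 2 by rewrite divr_gt0.
have [a a0 aP] := close (e / 2) e2; have [N NP] := natN a a0.
have [N' NP'] := up (e / 2) e2.
exists a; split; first exact: num_real.
move=> t /ltW ta /=.
have /riem_distP[l1 l1e j1] := NP' (maxn N N') (leq_maxr _ _).
have [l2 l2e j2] := aP t (maxn N N')%:R ta (NP _ (leq_maxl _ _)).
have [l3 l3l j3] := joined_sym mA fE mg (joined_cat j2 j1).
apply: eU j3 _; apply: (le_lt_trans l3l); lra.
Qed.

End Completeness.

Section WarpedComplete.
Context {R : realType} {E : normedModType R} (F : atlas E) (mF : manifold F)
  (fE : fincoord E).
Local Notation L := (line_prod F).

Lemma line_curve (c : R -> pt L) : C1_curve c ->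
  [/\ C1_curve (A := F) (snd \o c),
    forall t : R, is_derive t 1 (fst \o c) (derive1 (fst \o c) t),
    continuous (derive1 (fst \o c)) &
    forall (i : ix F) t, dom i (c t).2 ->
      @velocity R _ L c i t = (derive1 (fst \o c) t, velocity (A := F) (snd \o c) i t)].
Proof.
move=> [sc cc cd].
have c1 : continuous (fst : R * E -> R) by move=> z; exact: cvg_fst.
have c2 : continuous (snd : R * E -> E) by move=> z; exact: cvg_snd.
have key (i : ix F) t : dom i (c t).2 ->
  [/\ derivable (fst \o c) t 1, derivable (fwd i \o (snd \o c)) t 1,
    derive1 (fst \o c) t = (@velocity R _ L c i t).1 &
    velocity (A := F) (snd \o c) i t = (@velocity R _ L c i t).2].
  move=> di; have [dc _] := cd i t di.
  have [|d1 e1] := @derive1_diff_comp R _ _ _ (fst : R * E -> R) t dc.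
    exact: linear_differentiable.
  have [|d2 e2] := @derive1_diff_comp R _ _ _ (snd : R * E -> E) t dc.
    exact: linear_differentiable.
  split=> //.
  - by have := e1; rewrite diff_lin.
  - by have := e2; rewrite diff_lin.
have sF t : exists i : ix F, dom i (c t).2 by have [i di] := sc t; exists i.
have snc : continuous (snd \o c).
  by move=> t; apply: continuous_comp; [exact: cc|exact: cvg_snd].
have oU (i : ix F) : open ((snd \o c) @^-1` dom i).
  by apply: open_comp => [s _|]; [exact: snc|exact: dom_open].
split.
- split=> [t|//|i t di]; first exact: sF.
  have [_ d2 _ _] := key i t di; split=> //.
  suff : Ck 0 ((snd \o c) @^-1` dom i) (velocity (A := F) (snd \o c) i) by move=> /(_ t); apply.
  apply: (Ck_eq (f := snd \o @velocity R _ L c i) (oU i)).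
    by move=> s ds; have [_ _ _ ->] := key i s ds.
  move=> s ds; apply: continuous_comp; last exact: c2.
  by have [] := cd i s ds.
- move=> t; have [i di] := sF t; have [d1 _ _ _] := key i t di.
  by rewrite derive1E; exact: derivableP.
- move=> t; have [i di] := sF t.
  suff : Ck 0 ((snd \o c) @^-1` dom i) (derive1 (fst \o c)) by move=> /(_ t); apply.
  apply: (Ck_eq (f := fst \o @velocity R _ L c i) (oU i)).
    by move=> s ds; have [_ _ -> _] := key i s ds.
  move=> s ds; apply: continuous_comp; last exact: c1.
  by have [] := cd i s ds.
- by move=> i t di; have [_ _ -> ->] := key i t di; exact: surjective_pairing.
Qed.

Variable gF : bilin_field F.
Hypothesis rF : riemannian gF.

Lemma fincoord_line : fincoord ((R * E)%type : normedModType R).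
Proof. by apply: fincoord_prod => //; exact: fincoord_R. Qed.

Let mL := line_manifold mF.
Let rL := warped_riemannian mF rF.
Let fL := fincoord_line.

Lemma warped_speed (c : R -> pt L) (t : R) : C1_curve c ->
  `|derive1 (fst \o c) t| <= speed (warped_metric gF) c t /\
  speed gF (snd \o c) t <= expR (2 * (c t).1) * speed (warped_metric gF) c t.
Proof.
move=> Cc; have [C2 d1 _ vE] := line_curve Cc.
have [i di] : exists i : ix F, dom i (c t).2 by case: Cc => sc _ _; exact: sc.
rewrite (speed_chart mF rF.1 C2 di) (speed_chart mL rL.1 Cc di) /warped_metric vE//=.
set s' := derive1 _ _; set G := gF _ _ _ _.
have G0 : 0 <= G.
  have ii : img i (fwd i (c t).2) by exists (c t).2.
  have [[gl _ _ _] gpos] := rF.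
  exact: (bform_ge0 (fun u => gl i _ u ii) (fun u => gpos i _ u ii)).
have e0 := expR_gt0 (- 4 * (c t).1).
split.
  rewrite -sqrtr_sqr; apply: ler_wsqrtr; rewrite expr2 lerDl mulr_ge0// ltW.
have -> : expR (2 * (c t).1) = Num.sqrt (expR (2 * (c t).1) ^+ 2).
  by rewrite sqrtr_sqr ger0_norm// expR_ge0.
rewrite -sqrtrM ?sqr_ge0//; apply: ler_wsqrtr.
have ee : expR (2 * (c t).1) ^+ 2 * expR (-4 * (c t).1) = 1.
  by rewrite expr2 -!expRD -[RHS]expR0; congr expR; ring.
by rewrite mulrDr (mulrA _ (expR _)) ee mul1r lerDr mulr_ge0 ?expR_ge0// -expr2 sqr_ge0.
Qed.

(** A path of length l climbs at most l, and below the height S the factor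
   e^(-4s) of g_F is at least e^(-4S): the projection to F is at most e^(2S)
   times as long. *)
Lemma warped_joined p q l : joined (warped_metric gF) p q l ->
  `|q.1 - p.1| <= l /\ forall S, p.1 + l <= S ->
    exists2 l', l' <= expR (2 * S) * l & joined gF p.2 q.2 l'.
Proof.
elim=> {p q l} [c Cc|p q r l1 l2 j1 [h1 h1'] j2 [h2 h2']]; last first.
  have l10 := joined_ge0 mL fL rL.1 j1; have l20 := joined_ge0 mL fL rL.1 j2.
  split.
    have -> : r.1 - p.1 = (q.1 - p.1) + (r.1 - q.1) by rewrite [RHS]addrC addrA subrK.
    by apply: (le_trans (ler_normD _ _)); exact: lerD.
  move=> S hS; have [|l1' ll1 jj1] := h1' S; first lra.
  have [|l2' ll2 jj2] := h2' S; first by move: h1; rewrite ler_norml => /andP[_]; lra.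
  by exists (l1' + l2'); [rewrite mulrDr lerD|exact: joined_cat jj1 jj2].
have [C2 d1 _ _] := line_curve Cc.
have [K [K0 dK KE]] := arclength mL fL rL.1 Cc.
have sp t := warped_speed t Cc.
have bnd (t : R) : 0 <= t <= 1 -> (c t).1 <= (c 0).1 + K t.
  move=> /andP[t0 t1].
  have : (c 0).1 + K 0 - (c 0).1 <= (c 0).1 + K t - (c t).1; last by rewrite K0; lra.
  apply: (@derive_ge0_le _ (fun t => (c 0).1 + K t - (c t).1)
    (fun t => speed (warped_metric gF) c t - derive1 (fst \o c) t) 0 t t0).
    move=> s /andP[s0 st].
    have hs : 0 <= s <= 1 by rewrite s0 (le_trans st).
    have h1 := @is_deriveD R R R (cst (c 0).1) K s 1 0 _ (is_derive_cst _ _ _) (dK s hs).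
    by have := is_deriveB h1 (d1 s); rewrite add0r.
  move=> s _; rewrite subr_ge0; apply: (le_trans (ler_norm _)); exact: (sp s).1.
have Kmon (t : R) : 0 <= t <= 1 -> K t <= K 1.
  move=> /andP[t0 t1]; apply: (@derive_ge0_le _ K (speed (warped_metric gF) c) t 1 t1).
    by move=> s /andP[ts s1]; apply: dK; rewrite s1 (le_trans t0).
  by move=> s _; exact: speed_ge0.
rewrite KE; split.
  rewrite ler_norml; apply/andP; split.
    rewrite -KE lerNl opprB.
    have -> : (c 0).1 - (c 1).1 = (- (fst \o c)) 1 - (- (fst \o c)) 0 by rewrite !fctE /=; ring.
    apply: (@length_ge _ _ _ mL fL (warped_metric gF) c (- (fst \o c))
       (fun t => - derive1 (fst \o c) t) rL.1 Cc).
    move=> t _; apply: le_trans (sp t).1; rewrite -normrN; exact: ler_norm.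
  rewrite -KE.
  apply: (@length_ge _ _ _ mL fL (warped_metric gF) c (fst \o c)
       (derive1 (fst \o c)) rL.1 Cc).
  move=> t _; apply: le_trans (sp t).1; exact: ler_norm.
move=> S hS.
exists (\int[lebesgue_measure]_(t in `[0, 1]) speed gF (snd \o c) t); last exact: (joined_C1 gF C2).
have -> : expR (2 * S) * K 1 = (fun t => expR (2 * S) * K t) 1 - (fun t => expR (2 * S) * K t) 0.
  by rewrite K0 mulr0 subr0.
apply: (@length_le _ _ _ mF fE gF (snd \o c) (fun t => expR (2 * S) * K t)
  (fun t => expR (2 * S) * speed (warped_metric gF) c t) rF.1 C2).
  by move=> t /dK d; exact: (@is_deriveZ R R R K (expR (2 * S)) t 1 _ d).
move=> t t01; apply: (le_trans (sp t).2); apply: ler_wpM2r; first exact: speed_ge0.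
by rewrite ler_expR ler_pM2l//; have := bnd t t01; have := Kmon t t01; lra.
Qed.

Lemma warped_complete : complete_metric gF -> complete_metric (warped_metric gF).
Proof.
move=> cF u su uC.
have R1 : cauchy_ex ((fun k => (u k).1) @ \oo).
  move=> e e0; have [N NP] := uC e e0; exists (u N).1; exists N => // k /= Nk.
  have /riem_distP[l le jl] := NP k N Nk (leqnn N).
  have [h _] := warped_joined jl.
  by rewrite /ball /=; exact: le_lt_trans le.
have /R_complete/cvg_ex[s us] : cauchy ((fun k => (u k).1) @ \oo) by exact: cauchy_exP.
have [N1 NP1] := uC 1 ltr01.
(* From N1 on the heights are below u N1 + 1, and paths of length at most 1
   between these points stay below S. *)
pose S := (u N1).1 + 2.
have [|y sy uy] := cF (fun k => (u k).2) su.
  move=> e e0.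
  have d0 : 0 < Num.min 1 (e / expR (2 * S)) by rewrite lt_min ltr01 divr_gt0// expR_gt0.
  have [N NP] := uC _ d0; exists (maxn N1 N) => a b.
  rewrite !geq_max => /andP[a1 a2] /andP[b1 b2].
  have /riem_distP[l le jl] := NP a b a2 b2.
  move: le; rewrite lt_min => /andP[l1 l2].
  have [_ /(_ S) h] := warped_joined jl.
  have /riem_distP[l3 l3e jl3] := NP1 N1 a (leqnn _) a1.
  have [h3 _] := warped_joined jl3.
  have [|l' ll' jl'] := h.
    by move: h3; rewrite ler_norml /S => /andP[_]; lra.
  apply/riem_distP; exists l' => //; apply: (le_lt_trans ll').
  by rewrite mulrC -ltr_pdivlMr// expR_gt0.
exists ((s, y) : pt L); first exact: sy.
apply/(riem_cvgP mL fL _ rL); first exact: sy.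
have uy' : (fun k => (u k).2) @ \oo --> y by apply/(riem_cvgP mF fE _ rF).
have -> : u = (fun k => ((u k).1, (u k).2)) by apply/funext => k; case: (u k).
exact: (cvg_pair us uy').
Qed.

End WarpedComplete.

(** * The ends of a curve of bounded time *)

Section TimelikeEnd.
Context {R : realType}.

Lemma nowhere0_sign (f : R -> R) : continuous f -> (forall t, f t != 0) ->
  (forall t, 0 < f t) \/ (forall t, f t < 0).
Proof.
move=> fc f0.
have key a b : a <= b -> f a * f b < 0 -> False.
  move=> ab fab.
  have [|c _ /eqP] := IVT ab (continuous_subspaceT fc) (v := 0).
    rewrite ge_min le_max; case: (ltrgtP (f a) 0) => [fa|fa|/eqP]; last by rewrite (negPf (f0 a)).
      by move: fab; rewrite nmulr_rlt0// => fb; rewrite (ltW fb) orbT.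
    by move: fab; rewrite pmulr_rlt0// => fb; rewrite (ltW fb).
  by rewrite (negPf (f0 c)).
have key' a b : 0 < f a -> f b < 0 -> False.
  move=> fa fb; have [ab|/ltW ba] := leP a b.
    by apply: (key a b ab); rewrite pmulr_rlt0.
  by apply: (key b a ba); rewrite mulrC pmulr_rlt0.
case: (ltrgtP (f 0) 0) => [h|h|/eqP]; last by rewrite (negPf (f0 0)).
  right=> t; case: (ltrgtP (f t) 0) => [//|ht|/eqP]; last by rewrite (negPf (f0 t)).
  by case: (key' t 0).
left=> t; case: (ltrgtP (f t) 0) => [ht|//|/eqP]; last by rewrite (negPf (f0 t)).
by case: (key' 0 t).
Qed.

Lemma ndecr_cvg (T dT : R -> R) (M : R) : (forall t : R, is_derive t 1 T (dT t)) ->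
  (forall t, 0 <= t -> 0 <= dT t) -> (forall t, 0 <= t -> T t <= M) ->
  exists m, [/\ T @ +oo --> m, T 0 <= m & m <= M].
Proof.
move=> Td T0 TM.
pose B := [set T t | t in [set t : R | 0 <= t]].
have hB : has_sup B.
  by split; [exists (T 0), 0 => //=|exists M => _ [t t0 <-]; exact: TM].
have Ss t : 0 <= t -> T t <= sup B.
  by move=> t0; apply: ub_le_sup; [exact: hB.2|exists t].
exists (sup B); split; last 2 first.
- exact: Ss.
- by apply: ge_sup; [exists (T 0), 0 => //=|move=> _ [t t0 <-]; exact: TM].
apply/cvgrPdist_lt => e e0.
have [_ [a a0 <-] aP] := sup_adherent e0 hB.
exists a; split; first exact: num_real.
move=> t /ltW ta; have t0 := le_trans a0 ta.
rewrite ger0_norm ?subr_ge0; last exact: Ss.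
have : T a <= T t.
  by apply: (@derive_ge0_le _ T dT a t ta) => // r /andP[ar _]; apply: T0; exact: le_trans ar.
lra.
Qed.

(** Here x is the spatial part and T the time of a causal curve, and sg is the
   direction of time along it. Since T is monotone and bounded, it converges;
   since the length of x is at most k^-1 times the change of T, x converges
   too. *)
Lemma timelike_end (E : normedModType R) (A : atlas E) (mA : manifold A) (fE : fincoord E)
    (g : bilin_field A) (x : R -> pt A) (T dT : R -> R) (sg M k : R) :
  riemannian g -> complete_metric g -> C1_curve x ->
  (forall t : R, is_derive t 1 T (dT t)) -> (sg = 1 \/ sg = -1) -> 0 < k ->
  (forall t, 0 <= t -> k * speed g x t <= sg * dT t) ->
  (forall t, 0 <= t -> sg * T t <= M) ->
  exists m q, [/\ supp q, (fun t => (T t, x t)) @ +oo --> (m, q),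
    sg * T 0 <= sg * m & sg * m <= M].
Proof.
move=> rg cg Cx Td sgE k0 sp TM.
have d1 (t : R) : is_derive t 1 (sg *: T) (sg * dT t).
  exact: (@is_deriveZ R R R T sg t 1 _ (Td t)).
have d2 (t : R) : is_derive t 1 (k^-1 *: (sg *: T)) (k^-1 * (sg * dT t)).
  exact: (@is_deriveZ R R R (sg *: T) k^-1 t 1 _ (d1 t)).
have [||q sq xq] := @curve_cvg R E A mA fE g x _ _ (k^-1 * M) rg cg Cx d2.
- move=> t t0; rewrite -(ler_pM2l k0) mulrA mulfV ?gt_eqF// mul1r; exact: sp.
- by move=> t t0; apply: ler_wpM2l; [rewrite invr_ge0 ltW|exact: TM].
have [||m [Tm m0 mM]] := @ndecr_cvg (sg *: T) _ M d1.
- by move=> t t0; apply: le_trans (sp t t0); rewrite mulr_ge0 ?(ltW k0)// speed_ge0.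
- exact: TM.
have sg2 : sg * sg = 1 by case: sgE => ->; rewrite ?mulrNN mulr1.
exists (sg * m), q; split=> //; last 2 first.
- by rewrite mulrA sg2 mul1r.
- by rewrite mulrA sg2 mul1r.
have Tm' : T @ +oo --> sg * m.
  rewrite (_ : T = (fun t => sg * (sg *: T) t)).
    by apply: cvgM; [exact: cvg_cst|exact: Tm].
  by apply/funext => t; rewrite fctE -[_ *: _]/(sg * T t) mulrA sg2 mul1r.
exact: (cvg_pair Tm' xq).
Qed.

End TimelikeEnd.

(** * The cylinder: causality and the splitting of the metric *)

Section Cylinder.
Context {R : realType} {E : normedModType R} (F : atlas E) (mF : manifold F)
  (fE : fincoord E) (gF : bilin_field F) (rF : riemannian gF)
  (cF : complete_metric gF) (F0 : supp (A := F) !=set0)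
  (H : endo_field (line_prod F)) (sH : smooth_endo H)
  (Hsym : forall (i : ix (line_prod F)) x u v, img i x ->
     warped_metric gF i x (H i x u) v = warped_metric gF i x u (H i x v))
  (Hpos : exists2 c : R, 0 < c & forall l, eigenvalues H l -> c <= l).
Local Notation M := (line_prod F).
Local Notation C := (cylinder H).
Local Notation wp := (warped_metric gF).
Local Notation h t := (pull_metric wp (shift_endo H t)).

Let mM : manifold M := line_manifold mF.
Let rM : riemannian wp := warped_riemannian mF rF.
Let fM := fincoord_line fE.
Let cM : complete_metric wp := warped_complete mF fE rF cF.

Lemma line_neq0 : exists v : (R * E)%type, v != 0.
Proof. by exists (1, 0); apply/eqP => -[/eqP]; rewrite oner_eq0. Qed.

(** The set of negative eigenvalues is empty, which puts the left end at -oo;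
   there is at least one eigenvalue, which makes the right end finite. *)
Lemma cyl_bounds : exists beta : R,
  [/\ forall l, eigenvalues H l -> beta <= l, cyl_left H = -oo%E &
    cyl_right H = (beta / 2)%:E].
Proof.
have [c c0 Hc] := Hpos.
have [p [i di]] := F0.
have [|mu emu _] := @rayleigh_endo R _ M fM wp H rM sH Hsym line_neq0 i (0, fwd i p).
  by rewrite line_img; split=> //; exists p.
pose P := [set l | eigenvalues H l /\ 0 < l].
have PE : P = eigenvalues H.
  apply/seteqP; split=> [l []//|l el]; split=> //; exact: lt_le_trans (Hc l el).
have lbP : has_lbound P by exists c => l; rewrite PE => /Hc.
exists (inf P); split.
- by move=> l; rewrite -PE => Pl; exact: ge_inf.
- rewrite /cyl_left (_ : [set l | _ ] = set0).
    by rewrite image_set0 ereal_sup0 gt0_muleNy// lte_fin invr_gt0.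
  apply/seteqP; split=> // l [/Hc cl l0]; have := le_lt_trans cl l0.
  by rewrite ltNge ltW.
- rewrite /cyl_right -/P ereal_inf_EFin//; last by exists mu; rewrite PE.
  by rewrite -EFinM mulrC.
Qed.

Section Fixed.
Variable beta : R.
Hypothesis Hbeta : forall l, eigenvalues H l -> beta <= l.
Hypothesis leftE : cyl_left H = -oo%E.
Hypothesis rightE : cyl_right H = (beta / 2)%:E.

Lemma h_riemannian t : 2 * t < beta -> riemannian (h t).
Proof. by move=> tb; exact: (shift_riemannian mM fM rM sH Hsym line_neq0 Hbeta). Qed.

Lemma h_lower t (i : ix M) x v : @img R _ M i x -> 2 * t < beta ->
  (beta - 2 * t) ^+ 2 * wp i x v v <= h t i x v v.
Proof. by move=> ix tb; exact: (shift_metric_lower fM rM sH Hsym line_neq0 Hbeta). Qed.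

Lemma h_complete t : 2 * t < beta -> complete_metric (h t).
Proof.
move=> tb; have b0 : 0 < beta - 2 * t by rewrite subr_gt0.
apply: (complete_compare mM fM rM (h_riemannian tb) b0 _ cM).
by move=> i x v ix; exact: h_lower.
Qed.

Lemma cyl_dom (i : ix C) p : dom i p <-> dom (i : ix F) p.2.2 /\ 2 * p.1 < beta.
Proof.
rewrite /cylinder /=; split=> -[di].
  by rewrite leftE rightE /= lte_fin => -[_ pb]; split=> //; lra.
by move=> pb; split=> //=; rewrite leftE rightE ltNyr lte_fin; split=> //; lra.
Qed.

Lemma cyl_supp p : supp (A := C) p <-> supp (A := F) p.2.2 /\ 2 * p.1 < beta.
Proof.
split=> [[i /cyl_dom[di pb]]|[[i di] pb]]; first by split=> //; exists i.
by exists i; apply/cyl_dom.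
Qed.

Lemma cyl_img (i : ix C) x : img i x <-> @img R _ M i x.2 /\ 2 * x.1 < beta.
Proof.
split=> [[p /cyl_dom[di pb] <-]|]; first by split=> //; exists p.2.
move=> [[q dq]]; case: x => s y /= <- xb; exists (s, q) => //.
exact/cyl_dom.
Qed.

Lemma cyl_img2 (i j : ix C) x : (fwd i @` (dom i `&` dom j)) x ->
  (@fwd R _ M i @` (@dom R _ M i `&` @dom R _ M j)) x.2 /\ 2 * x.1 < beta.
Proof. by move=> [p [/cyl_dom[di pb] /cyl_dom[dj _]] <-]; split=> //; exists p.2. Qed.

Lemma cyl_open : open [set p : R * (R * pt F) |
  (cyl_left H < p.1%:E)%E /\ (p.1%:E < cyl_right H)%E].
Proof.
have -> : [set p : R * (R * pt F) | (cyl_left H < p.1%:E)%E /\ (p.1%:E < cyl_right H)%E]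
  = fst @^-1` [set t | t < beta / 2].
  apply/seteqP; split=> p /=; rewrite leftE rightE lte_fin; first by case.
  by rewrite ltNyr.
by apply: open_comp; [move=> p _; exact: cvg_fst|exact: open_lt].
Qed.

Lemma cyl_manifold : manifold C.
Proof. by apply: restrict_manifold; [exact: line_manifold|exact: cyl_open]. Qed.

Lemma cyl_trans (i j : ix C) (x u : R * (R * E)) : (fwd i @` (dom i `&` dom j)) x ->
  'd (trans i j) x u = (u.1, 'd (@trans R _ M i j) (x.2) (u.2)).
Proof. by move=> /cyl_img2[xij _]; exact: (diff_line_trans mM). Qed.

Lemma cyl_metric_field : metric_field (cylinder_metric gF H).
Proof.
split.
- move=> i x u /cyl_img[ix tb] a v w.
  have [[gl _ _ _] _] := h_riemannian tb.
  change (- (u.1 * (a * v.1 + w.1)) + h x.1 i x.2 u.2 (a *: v.2 + w.2) =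
    a * (- (u.1 * v.1) + h x.1 i x.2 u.2 v.2) + (- (u.1 * w.1) + h x.1 i x.2 u.2 w.2)).
  have hE : h x.1 i x.2 u.2 (a *: v.2 + w.2) =
    a * h x.1 i x.2 u.2 v.2 + h x.1 i x.2 u.2 w.2 by exact: (gl i x.2 u.2 ix a v.2 w.2).
  by rewrite hE mulrDr opprD addrACA (mulrCA u.1) -mulrN -mulrDr.
- move=> i x u v /cyl_img[ix tb]; have [[_ gs _ _] _] := h_riemannian tb.
  change (- (u.1 * v.1) + h x.1 i x.2 u.2 v.2 = - (v.1 * u.1) + h x.1 i x.2 v.2 u.2).
  by rewrite gs// mulrC.
- move=> i u v k.
  have oU : open (img i) by exact: (img_open cyl_manifold).
  change (Ck k (img i) (fun x : R * (R * E) => - (u.1 * v.1) + h x.1 i x.2 u.2 v.2)).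
  apply: Ck_add => //; first exact: Ck_cst.
  apply: (shift_metric_Ck mM fM u.2 v.2 rM.1 sH oU).
  + by move=> x /cyl_img[].
  + exact: Ck_fst.
  + exact: Ck_snd.
- move=> i j x u v xij; rewrite !cyl_trans//; have [xij2 tb] := cyl_img2 xij.
  have [[_ _ _ gt] _] := h_riemannian tb.
  change (- (u.1 * v.1) + h x.1 i x.2 u.2 v.2 = - (u.1 * v.1) +
    h x.1 j (@trans R _ M i j x.2) ('d (@trans R _ M i j) (x.2) (u.2))
      ('d (@trans R _ M i j) (x.2) (v.2))).
  by rewrite (gt i j).
Qed.

Lemma cyl_lorentzian : lorentzian (cylinder_metric gF H).
Proof.
split; first exact: cyl_metric_field.
move=> i x /cyl_img[ix tb]; have [[gl gs _ _] gpos] := h_riemannian tb.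
have gl' u : scalar (h x.1 i x.2 u) by exact: gl.
have gs' u v : h x.1 i x.2 u v = h x.1 i x.2 v u by exact: gs.
have g0 v : h x.1 i x.2 0 v = 0 by rewrite gs' (bform0r gl').
exists (1, 0).
  change (- (1 * 1) + h x.1 i x.2 0 0 < 0).
  by rewrite g0 addr0 mulr1 oppr_lt0.
move=> v; change (- (1 * v.1) + h x.1 i x.2 0 v.2 = 0 -> v != 0 ->
  0 < - (v.1 * v.1) + h x.1 i x.2 v.2 v.2).
rewrite g0 addr0 mul1r => /eqP; rewrite oppr_eq0 => /eqP v1.
rewrite v1 mul0r oppr0 add0r => v0; apply: gpos => //.
by apply: contra_neq v0; case: v v1 => ? ? /= -> ->.
Qed.

Lemma cyl_time_orientable : time_orientable (cylinder_metric gF H).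
Proof.
exists (fun _ _ => (1, 0)); split.
- by move=> i x _; exact: cst_continuous.
- by move=> i j x xij; rewrite cyl_trans//= linear0.
- move=> i x /cyl_img[ix tb]; have [[gl gs _ _] gpos] := h_riemannian tb.
  change (- (1 * 1) + h x.1 i x.2 0 0 < 0).
  by rewrite (bform0r (fun u => gl i x.2 u ix)) addr0 mulr1 oppr_lt0.
Qed.

(** Time is strictly monotone along a timelike curve. If it omits t0, then at
   one of the two ends it is bounded and stays away from beta / 2, so that
   timelike_end provides an end point there. *)
Lemma cyl_cauchy (t0 : R) : 2 * t0 < beta ->
  cauchy_hypersurface (cylinder_metric gF H)
    [set p : R * (R * pt F) | supp (A := C) p /\ p.1 = t0].
Proof.
move=> t0b; split=> [p []//|c [Cc ctl] [cp cn]].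
have [sc cc cd] := Cc.
have [sF cb] : (forall t, supp (A := F) (c t).2.2) /\ (forall t, 2 * (c t).1 < beta).
  by split=> t; have /cyl_supp[] := sc t.
have CL : @C1_curve R _ (line_prod M) c.
  split=> [t|//|i t di]; first by have [i di] := sF t; exists i.
  by apply: (cd i t); apply/cyl_dom.
have [Cx Td dTc vE] := line_curve mM CL.
pose T := fst \o c; pose x := snd \o c; pose dT := derive1 T.
(* A vector (T', x') is timelike when |(H - 2T) x'| < |T'|. *)
have wps t : (beta - 2 * T t) * speed wp x t < `|dT t|.
  have [i di] := sF t.
  have dC : @dom R _ C i (c t) by apply/cyl_dom.
  have := ctl i t dC.
  change (velocity c i t) with (@velocity R _ (line_prod M) c i t); rewrite vE//.
  change (- (dT t * dT t) + h (T t) i (@fwd R _ M i (x t)) (@velocity R _ M x i t)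
     (@velocity R _ M x i t) < 0 -> (beta - 2 * T t) * speed wp x t < `|dT t|).
  have ix : @img R _ M i (@fwd R _ M i (x t)) by exists (x t).
  have bT : 0 < beta - 2 * T t by rewrite subr_gt0; exact: cb.
  have := h_lower (@velocity R _ M x i t) ix (cb t).
  rewrite (@speed_chart R _ M mM wp x i t rM.1 Cx di).
  set v := velocity x i t; rewrite -/(T t) => hl hn.
  rewrite -[X in X * Num.sqrt _]gtr0_norm// -sqrtr_sqr -sqrtrM ?sqr_ge0//.
  rewrite -[X in _ < X]sqrtr_sqr ltr_sqrt; first by rewrite expr2; apply: (le_lt_trans hl); move: hn; rewrite addrC subr_lt0.
  have wv : 0 <= wp i (fwd (a := M) i (x t)) v v.
    have [[gl _ _ _] gpos] := rM.
    exact: (bform_ge0 (fun u => gl i _ u ix) (fun u => gpos i _ u ix)).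
  rewrite lt_neqAle sqr_ge0 andbT eq_sym sqrf_eq0; apply/eqP => d0.
  by move: hn; rewrite d0 mul0r oppr0 add0r ltNge (le_trans _ hl)// mulr_ge0// sqr_ge0.
have dT0 t : dT t != 0.
  rewrite -normr_gt0; apply: le_lt_trans (wps t).
  by rewrite mulr_ge0 ?speed_ge0// subr_ge0 ltW// cb.
have Tc : continuous T.
  by move=> t; apply: continuous_comp; [exact: cc|exact: cvg_fst].
have uniqT s t : T s = T t -> s = t.
  have lt_neq a b : a < b -> T a = T b -> False.
    move=> ab Tab.
    have [r _ /eqP] := @MVT_segment R T dT a b (ltW ab) (fun r _ => Td r)
      (continuous_subspaceT Tc).
    by rewrite Tab subrr eq_sym mulf_eq0 subr_eq0 (gt_eqF ab) orbF (negPf (dT0 r)).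
  by case: (ltrgtP s t) => // st Tst; [case: (lt_neq s t)|case: (lt_neq t s)].
have Sc t : (supp (A := C) (c t) /\ (c t).1 = t0) <-> T t = t0.
  by split=> [[]//|Tt]; split=> //; exact: sc.
suff [t Tt] : exists t, T t = t0.
  exists t; split; first by apply/Sc.
  by move=> t' /Sc Tt'; apply: uniqT; rewrite Tt Tt'.
apply: contrapT => noT.
have sgn : (forall t, 0 < T t - t0) \/ (forall t, T t - t0 < 0).
  apply: nowhere0_sign.
    by move=> t; apply: continuousB; [exact: Tc|exact: cst_continuous].
  by move=> t; apply/eqP => /eqP; rewrite subr_eq0 => /eqP Tt; apply: noT; exists t.
have sgn' := nowhere0_sign dTc dT0.
(* The end at -oo is the end at +oo of the reversed curve. *)
pose opp (t : R) := 0 + -1 * t.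
have oppd (t : R) : is_derive t 1 opp (-1) by exact: is_derive_affine.
have oppc : continuous (fun _ : R => -1 : R) by move=> t; exact: cst_continuous.
have oppE t : opp t = - t by rewrite /opp add0r mulN1r.
have [Cxo _] := reparam mM Cx oppd oppc.
have Tdo (t : R) : is_derive t 1 (T \o opp) (- dT (opp t)).
  have := @is_derive1_comp R T opp t _ _ (Td (opp t)) (oppd t).
  by rewrite mulrN1.
have spo t : speed wp (x \o opp) t = speed wp x (opp t).
  by rewrite (speed_reparam mM t rM.1 Cx oppd oppc) normrN normr1 mul1r.
have wps2 (t1 : R) t : 2 * t1 < beta -> T t <= t1 ->
    (beta - 2 * t1) * speed wp x t <= `|dT t|.
  move=> tb Tt; apply: le_trans (ltW (wps t)); apply: ler_wpM2r; first exact: speed_ge0.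
  lra.
have fin_p (m : R) q : supp (A := M) q -> 2 * m < beta ->
    (fun t => (T t, x t)) @ +oo --> (m, q) -> False.
  move=> sq mb mq; apply: (cp (m, q)); first by apply/cyl_supp.
  have -> : c = (fun t => (T t, x t)) by apply/funext => t; rewrite /T /x /=; case: (c t).
  exact: mq.
have fin_n (m : R) q : supp (A := M) q -> 2 * m < beta ->
    (fun t => (T (opp t), x (opp t))) @ +oo --> (m, q) -> False.
  move=> sq mb mq; apply: (cn (m, q)); first by apply/cyl_supp.
  have -> : c = (fun t => (T t, x t)) by apply/funext => t; rewrite /T /x /=; case: (c t).
  move=> U /mq [a [ar aP]]; exists (- a); split; first exact: num_real.
  move=> t ta; have := aP (- t); rewrite /= oppE opprK; apply.
  by rewrite ltrNr.
have mono (s t : R) : s <= t -> (forall r, 0 < dT r) -> T s <= T t.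
  by move=> st d; apply: (@derive_ge0_le _ T dT s t st) => // r _; exact: ltW.
have mono' (s t : R) : s <= t -> (forall r, dT r < 0) -> T t <= T s.
  move=> st d; rewrite -lerN2.
  apply: (@derive_ge0_le _ (- T) (fun r => - dT r) s t st) => // r _.
  by rewrite oppr_ge0 ltW.
have k1 : 0 < beta - 2 * t0 by lra.
have hb : 2 * T 0 < beta by exact: cb.
have k2 : 0 < beta - 2 * T 0 by rewrite subr_gt0.
have one1 : (1 : R) = 1 \/ (1 : R) = -1 by left.
have one2 : (-1 : R) = 1 \/ (-1 : R) = -1 by right.
(* The relevant end is the one at which T approaches t0. There T stays below t0
   if the curve lies below the slice, and below T 0 if it lies above. *)
case: sgn => Tt0; case: sgn' => dTs.
- have [||m [q [sq mq m1 m2]]] := @timelike_end R _ M mM fM wp (x \o opp) (T \o opp) _ (-1) (- t0) _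
    rM cM Cxo Tdo one2 k2.
  + move=> t t_ge0; rewrite spo mulrNN mul1r -[X in _ <= X]gtr0_norm//.
    by apply: wps2; [exact: cb|apply: mono => //; rewrite oppE oppr_le0].
  + by move=> t _ /=; have := Tt0 (opp t); rewrite mulN1r; lra.
  apply: (fin_n m q) => //; move: m1; rewrite [(_ \o _) _]/= oppE oppr0; lra.
- have [||m [q [sq mq m1 m2]]] := @timelike_end R _ M mM fM wp x T _ (-1) (- t0) _
    rM cM Cx Td one2 k2.
  + move=> t t_ge0; rewrite mulN1r -[X in _ <= X]ltr0_norm//.
    by apply: wps2; [exact: cb|exact: mono'].
  + by move=> t _ /=; have := Tt0 t; rewrite mulN1r; lra.
  apply: (fin_p m q) => //; move: m1; lra.
- have [||m [q [sq mq m1 m2]]] := @timelike_end R _ M mM fM wp x T _ 1 t0 _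
    rM cM Cx Td one1 k1.
  + move=> t t_ge0; rewrite mul1r -[X in _ <= X]gtr0_norm//.
    by apply: wps2 => //; have := Tt0 t; lra.
  + by move=> t _ /=; have := Tt0 t; rewrite mul1r; lra.
  apply: (fin_p m q) => //; lra.
- have [||m [q [sq mq m1 m2]]] := @timelike_end R _ M mM fM wp (x \o opp) (T \o opp) _ 1 t0 _
    rM cM Cxo Tdo one1 k1.
  + move=> t t_ge0; rewrite spo mul1r -[X in _ <= X]ltr0_norm//.
    by apply: wps2 => //; have := Tt0 (opp t); lra.
  + by move=> t _ /=; have := Tt0 (opp t); rewrite mul1r; lra.
  apply: (fin_n m q) => //; lra.
Qed.

Lemma cyl_globally_hyperbolic : globally_hyperbolic (cylinder_metric gF H).
Proof.
split; [exact: cyl_manifold|exact: cyl_lorentzian|exact: cyl_time_orientable|].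
by eexists; apply: (@cyl_cauchy (beta / 2 - 1)); lra.
Qed.

(** Identifies the line with the interval of times below beta / 2. With this
   choice the derivative exp(-s) is half of beta - 2t, which makes the rate of
   change of the slices bounded. *)
Definition time_of (s : R) : R := beta / 2 - expR (- s).

Lemma time_of_lt s : 2 * time_of s < beta.
Proof. by rewrite /time_of; have := expR_gt0 (- s); lra. Qed.

Lemma time_of_derive (s : R) : is_derive s 1 time_of (expR (- s)).
Proof.
have d1 : is_derive s 1 (fun t : R => 0 + -1 * t) (-1) by exact: is_derive_affine.
have d2 := @is_derive1_comp R (@expR R) (fun t : R => 0 + -1 * t) s _ _ (is_derive_expR _) d1.
have d3 := @is_derive1_comp R (fun t => beta / 2 + (-1) * t) _ s _ _
  (is_derive_affine _ _ _) d2.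
have -> : time_of = (fun t => beta / 2 + (-1) * t) \o (@expR R \o (fun t : R => 0 + -1 * t)).
  by apply/funext => t; rewrite /time_of /= add0r !mulN1r.
by apply: (is_derive_eq d3); rewrite add0r !mulN1r mulrN1 opprK.
Qed.

Lemma Ck_expN k : Ck k setT (fun s : R => expR (- s)).
Proof.
apply: (@Ck_comp _ k R R R setT setT (fun s : R => - s) (@expR R)) => //.
- exact: openT.
- exact: openT.
- by apply: Ck_opp; [exact: openT|exact: Ck_id].
- by apply: Ck_expR; exact: openT.
Qed.

Lemma Ck_time_of k : Ck k setT time_of.
Proof.
apply: Ck_add; [exact: openT|exact: Ck_cst|].
by apply: Ck_opp; [exact: openT|exact: Ck_expN].
Qed.

Definition time_inv (t : R) : R := - ln (beta / 2 - t).

Lemma time_ofK : cancel time_of time_inv.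
Proof. by move=> s; rewrite /time_inv /time_of subKr expRK opprK. Qed.

Lemma time_invK t : 2 * t < beta -> time_of (time_inv t) = t.
Proof. by move=> tb; rewrite /time_inv /time_of opprK lnK ?subKr// posrE; lra. Qed.

Lemma Ck_time_inv k : Ck k [set t | 2 * t < beta] time_inv.
Proof.
have oU : open [set t : R | 2 * t < beta].
  have -> : [set t : R | 2 * t < beta] = [set t | t < beta / 2].
    by apply/seteqP; split=> t /=; lra.
  exact: open_lt.
have oP : open [set x : R | 0 < x] by exact: open_gt.
have Cd : Ck k [set t : R | 2 * t < beta] (fun t => beta / 2 - t).
  by apply: Ck_add => //; [exact: Ck_cst|apply: Ck_opp => //; exact: Ck_id].
have dP (t : R) : 2 * t < beta -> 0 < beta / 2 - t by move=> tb; lra.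
by apply: Ck_opp => //; exact: (Ck_comp oU oP dP Cd (Ck_ln k)).
Qed.

Let sq_lapse (s : R) (_ : pt M) : R := expR (- s) ^+ 2.
Let slice (s : R) : bilin_field M := h (time_of s).

(** The derivative of g_t(v, v) is -4 t' g(Bv, v) for B = H - 2t, and
   g(Bv, v) <= g(Bv, Bv) / (beta - 2t) by Cauchy-Schwarz; finally, t' is half of
   beta - 2t. *)
Lemma slice_rate s l : rate_eigenvalues slice s l -> `|l| <= 2.
Proof.
move=> [i [x [v [ix v0 /(_ v) hl]]]].
have [mg gpos] := rM; have [gl gs _ _] := mg.
have gl' u : scalar (wp i x u) by exact: gl.
have gs' u w : wp i x u w = wp i x w u by exact: gs.
have gpos' u : u != 0 -> 0 < wp i x u u by exact: gpos.
set a := wp i x (H i x v) (H i x v); set b := wp i x (H i x v) v; set c := wp i x v v.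
have sE t : slice t i x v v = a - 4 * time_of t * b + 4 * time_of t ^+ 2 * c.
  rewrite /slice /pull_metric /shift_endo (bformBZl gl' gs') (gs' _ (_ - _)) (gs' v (_ - _)).
  by rewrite !(bformBZl gl' gs') (gs' v) -/a -/b -/c; ring.
pose P (y : R) := a + (-4 * b) * y + (4 * c) * (y * y).
have dP (y : R) : is_derive y 1 P (-4 * b + 4 * c * (2 * y)).
  have d1 := @is_deriveM R R id id y 1 1 1 (is_derive_id y 1) (is_derive_id y 1).
  have d2 := @is_deriveZ R R R (id * id) (4 * c) y 1 _ d1.
  have d3 := @is_deriveD R R R (fun y => a + (-4 * b) * y) _ y 1 _ _ (is_derive_affine _ _ _) d2.
  by apply: (is_derive_eq d3); rewrite -![_ *: _]/(_ * _) /=; ring.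
have dPt := @is_derive1_comp R P time_of s _ _ (dP _) (time_of_derive s).
have sPE : (fun t => slice t i x v v) = P \o time_of.
  by apply/funext => t; rewrite sE /P /=; ring.
rewrite sPE (is_derive_derive1 dPt) in hl.
set e := expR (- s) in hl; have e0 : 0 < e by exact: expR_gt0.
pose w := shift_endo H (time_of s) i x v.
have wv : wp i x w v = b - 2 * time_of s * c.
  by rewrite /w /shift_endo (bformBZl gl' gs').
have ww : slice s i x v v = wp i x w w by [].
have w0 : 0 < wp i x w w.
  by rewrite -ww; have [_ hp] := h_riemannian (time_of_lt s); exact: hp.
have h1 : (beta - 2 * time_of s) * c <= wp i x w v.
  exact: (shift_endo_lower fM rM sH Hsym line_neq0 Hbeta).
have kE : beta - 2 * time_of s = 2 * e by rewrite /time_of -/e; lra.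
rewrite kE in h1.
have c0 : 0 < c by exact: gpos'.
have h2 : wp i x w v ^+ 2 <= wp i x w w * c by exact: bform_cauchy_schwarz.
set y := wp i x w v in wv h1 h2.
have y0 : 0 < y by apply: lt_le_trans h1; rewrite !mulr_gt0.
have h3 : 2 * e * y <= wp i x w w.
  have e2 : 0 < 2 * e by rewrite mulr_gt0.
  have : 2 * e * (y ^+ 2) <= wp i x w w * y.
    apply: (@le_trans _ _ (2 * e * (wp i x w w * c))); first by rewrite ler_pM2l.
    by rewrite mulrCA ler_pM2l.
  by rewrite expr2 mulrA ler_pM2r.
rewrite ww in hl.
have hl' : l * wp i x w w = - (4 * e * y) by rewrite -hl wv; ring.
have {hl'} -> : l = - (4 * e * y / wp i x w w).
  by rewrite -mulNr -hl' mulfK// gt_eqF.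
rewrite normrN ger0_norm; last by rewrite divr_ge0 ?ltW// !mulr_gt0.
by rewrite ler_pdivrMr//; lra.
Qed.

Lemma slice_split : bbc_split sq_lapse slice.
Proof.
have oW (i : ix M) : open ([set: R] `*` @img R _ M i).
  by apply: openTX; exact: (img_open mM).
split.
- exact: mM.
- move=> i k; rewrite /sq_lapse.
  have C1 : @Ck R k (R * (R * E))%type R (setT `*` img i) (fun x => expR (- x.1)).
    apply: (@Ck_comp _ k _ _ _ _ setT fst (fun s : R => expR (- s))) => //.
    + exact: openT.
    + exact: Ck_fst.
    + exact: Ck_expN.
  have := Ck_mul (oW i) C1 C1.
  by apply: Ck_eq => // x _; rewrite expr2.
- by move=> t p _; rewrite exprn_gt0// expR_gt0.
- by move=> t; exists (expR (- t) ^+ 2).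
- move=> i u v k.
  apply: (@shift_metric_Ck R _ M mM fM wp H k _ _ i (time_of \o fst) snd u v rM.1 sH (oW i)).
  + by move=> x [].
  + apply: (@Ck_comp _ k _ _ _ _ setT fst time_of) => //.
    * exact: openT.
    * exact: Ck_fst.
    * exact: Ck_time_of.
  + exact: Ck_snd.
- by move=> t; apply: h_riemannian; exact: time_of_lt.
- by move=> t; apply: h_complete; exact: time_of_lt.
- by move=> t; exists 2 => l; exact: slice_rate.
Qed.

(** In charts the isometry is time_of on the line times a change of chart of M;
   its differential multiplies ds by exp(-s), the root of the coefficient of
   ds^2. *)
Lemma slice_isometric : isometric (split_metric sq_lapse slice) (cylinder_metric gF H).
Proof.
pose Phi (p : R * (R * pt F)) : R * (R * pt F) := (time_of p.1, p.2).
pose Psi (p : R * (R * pt F)) : R * (R * pt F) := (time_inv p.1, p.2).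
have oD (i j : ix F) : open (@fwd R _ M i @` (@dom R _ M i `&` @dom R _ M j)).
  exact: (open_dom2 mM).
have Ctr k (U : set (R * (R * E))) (i j : ix F) (f : R -> R) (V : set R) :
    open V -> Ck k V f ->
    U `<=` V `*` (@fwd R _ M i @` (@dom R _ M i `&` @dom R _ M j)) ->
    @Ck R k (R * (R * E))%type (R * (R * E))%type U
      (fun x => (f x.1, @trans R _ M i j x.2)).
  move=> oV CV UV; apply: Ck_sub UV _.
  have oVD := openX_prod oV (oD i j).
  apply: Ck_pair => //.
    apply: (@Ck_comp _ k _ _ _ _ V fst f) => //; first by move=> x [].
    exact: Ck_fst.
  apply: (@Ck_comp _ k _ _ _ _ _ snd (@trans R _ M i j) oVD (oD i j)).
  - by move=> x [].
  - exact: Ck_snd.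
  - exact: (trans_smooth mM).
have oU : open [set t : R | 2 * t < beta].
  have -> : [set t : R | 2 * t < beta] = [set t | t < beta / 2].
    by apply/seteqP; split=> t /=; lra.
  exact: open_lt.
exists Phi, Psi; split.
- split; split.
  + move=> p [i di]; split.
      by apply/cyl_supp; split; [exists i|exact: time_of_lt].
    apply: continuous_pair_at; last exact: cvg_snd.
    apply: (@continuous_comp _ _ _ fst time_of); first exact: cvg_fst.
    exact: (Ck_time_of 0).
  + move=> i j k; apply: (Ctr k _ i j time_of setT openT (Ck_time_of k)).
    by move=> _ [p [di /cyl_dom[dj _]] <-]; split=> //; exists p.2.
  + move=> p /cyl_supp[[i di] pb]; split; first by exists i.
    apply: continuous_pair_at; last exact: cvg_snd.
    apply: (@continuous_comp _ _ _ fst time_inv); first exact: cvg_fst.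
    exact: (Ck_time_inv 0).
  + move=> i j k; apply: (Ctr k _ i j time_inv _ oU (Ck_time_inv k)).
    by move=> _ [p [/cyl_dom[di pb] dj] <-]; split=> //; exists p.2.
- by move=> p _; rewrite /Psi /Phi /= time_ofK -surjective_pairing.
- by move=> q /cyl_supp[_ qb]; rewrite /Psi /Phi /= time_invK// -surjective_pairing.
- move=> i j p u v di /cyl_dom[dj _] /=.
  pose Y := @fwd R _ M i p.2; pose s := p.1.
  have xij : (@fwd R _ M i @` (@dom R _ M i `&` @dom R _ M j)) Y by exists p.2.
  have [dt tE] := is_derive_diff (time_of_derive s).
  have [_ dE] := @diff_prodmap R R _ R _ time_of (@trans R _ M i j) (s, Y) dt
    (trans_differentiable mM xij).
  have [[_ _ _ gt] _] := h_riemannian (time_of_lt s).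
  have tY : @trans R _ M i j Y = @fwd R _ M j p.2 by exact: trans_fwd.
  change (- (expR (- s) ^+ 2) * u.1 * v.1 + h (time_of s) i Y u.2 v.2 =
    let D w := 'd (fun y : R * (R * E) => (time_of y.1, @trans R _ M i j y.2)) (s, Y) w in
    - ((D u).1 * (D v).1) + h (time_of s) j (@fwd R _ M j p.2) (D u).2 (D v).2).
  have gE := gt i j _ u.2 v.2 xij; rewrite tY in gE.
  cbv beta zeta; rewrite !dE gE /= tE; congr (_ + _).
  by ring.
Qed.

Lemma cyl_bbc : bbc (cylinder_metric gF H).
Proof.
split; [exact: cyl_manifold|exact: cyl_lorentzian|].
by exists _, M, sq_lapse, slice; split; [exact: slice_split|exact: slice_isometric].
Qed.

End Fixed.
End Cylinder.

Theorem theorem2 (R : realType) (n : nat)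
    (F : atlas ('rV[R]_n : normedModType R)) (gF : bilin_field F)
    (H : endo_field (line_prod F))
    (F_manifold : manifold F)
    (F_connected : supp (A := F) !=set0 /\ connected (supp (A := F)))
    (gF_riemannian : riemannian gF)
    (F_spinor : admits_parallel_spinor gF)
    (F_codazzi : exists2 T : endo_field F, codazzi gF T &
      exists c : R, forall l, eigenvalues T l -> c <= l)
    (H_codazzi : codazzi (warped_metric gF) H)
    (H_positive : exists2 c : R, 0 < c & forall l, eigenvalues H l -> c <= l)
    (gF_complete : complete_metric gF) :
  globally_hyperbolic (cylinder_metric gF H) /\ bbc (cylinder_metric gF H).
Proof.
have fE := @fincoord_rV R n; have [F0 _] := F_connected.
have [sH Hsym _] := H_codazzi.
have [beta [bH lE rE]] := cyl_bounds F_manifold fE gF_riemannian F0 sH Hsym H_positive.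
split.
  exact: (cyl_globally_hyperbolic F_manifold fE gF_riemannian gF_complete sH Hsym bH lE rE).
exact: (cyl_bbc F_manifold fE gF_riemannian gF_complete sH Hsym bH lE rE).
Qed.
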